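(* Suppose that (W* ) the cost function $c$ is $\mathbb{K}$-inf-compact on $\mathbb{X}\times\mathbb{A}$, and the transition probability $q(\cdot|x,a)$ is weakly continuous in $(x,a)\in\mathbb{X}\times\mathbb{A}$; and that a sequence $\{\alpha_n\}_{n\ge1}\subset[0,1)$ with $\alpha_n\uparrow1$ satisfies ($\underline{B}_{\{\alpha_n\}}$) $w^*:=\inf_{x\in\mathbb{X}}w(x)<+\infty$ and $\liminf_{n\to\infty}u_{\alpha_n}(x)<+\infty$ for all $x\in\mathbb{X}$; (LEC$_{\{\alpha_n\}}$) (i) the sequence of functions $\{u_{\alpha_n}\}_{n\ge1}$ is lower semi-equicontinuous on $\mathbb{X}$; (ii) $\lim_{n\to\infty}u_{\alpha_n}(x)$ exists for each $x\in\mathbb{X}$; (iii) for each $x\in\mathbb{X}$ and $a\in\mathbb{A}$ the sequence $\{u_{\alpha_n}\}_{n\ge1}$ is asymptotically uniformly integrable with respect to the probability measure $q(\cdot|x,a)$. Let $u(x):=\liminf_{n\to\infty}u_{\alpha_n}(x)$, $x\in\mathbb{X}$. Then there exists a deterministic policy $\phi$ such that the average-cost optimality equation holds: $$w^*+u(x)=c(x,\phi(x))+\int_{\mathbb{X}}u(y)\,q(dy|x,\phi(x))=\min_{a\in\mathbb{A}}\left[c(x,a)+\int_{\mathbb{X}}u(y)\,q(dy|x,a)\right],\qquad x\in\mathbb{X}.$$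
   Context: Setting (MDP). The state space $\mathbb{X}$ and the action space $\mathbb{A}$ are Borel subsets of Polish spaces; every action in $\mathbb{A}$ is available at every state. The one-step cost $c:\mathbb{X}\times\mathbb{A}\to\mathbb{R}\cup\{+\infty\}$ is measurable and bounded below. The transition kernel $q(B|x,a)$ ($B\in\mathcal{B}(\mathbb{X})$) is a regular (measurable) transition probability from $\mathbb{X}\times\mathbb{A}$ to $\mathbb{X}$. A policy $\pi=(\pi_0,\pi_1,\dots)$ is a sequence of decision rules, $\pi_t$ being a regular transition probability from the histories $(\mathbb{X}\times\mathbb{A})^t\times\mathbb{X}$ to $\mathbb{A}$; $\Pi$ is the set of all policies. A deterministic policy is identified with a measurable map $\phi:\mathbb{X}\to\mathbb{A}$, which prescribes action $\phi(x)$ whenever the current state is $x$. For an initial state $x$ and policy $\pi$, $\mathbb{E}_x^\pi$ is the expectation with respect to the induced probability measure on trajectories $(x_0,a_0,x_1,a_1,\dots)$ (Ionescu Tulcea theorem). Criteria. $v_{N,\alpha}^\pi(x)=\mathbb{E}_x^\pi\sum_{t=0}^{N-1}\alpha^t c(x_t,a_t)$ for $N\in\{1,2,\dots\}$, $\alpha\in[0,1]$; $v_\alpha^\pi(x)=\mathbb{E}_x^\pi\sum_{t=0}^{\infty}\alpha^t c(x_t,a_t)$ for $\alpha\in[0,1)$; $v_\alpha(x)=\inf_{\pi\in\Pi}v_\alpha^\pi(x)$; $w^\pi(x)=\limsup_{N\to\infty}\frac1N v_{N,1}^\pi(x)$; $w(x)=\inf_{\pi\in\Pi}w^\pi(x)$.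 Notation. $m_\alpha=\inf_{x\in\mathbb{X}}v_\alpha(x)$ (finite for all $\alpha\in[0,1)$ when $w^*<+\infty$), $u_\alpha(x)=v_\alpha(x)-m_\alpha$. Definitions. A function $f:\mathbb{U}\to\mathbb{R}\cup\{+\infty\}$ on a metric space $\mathbb{U}$ is inf-compact if for every $\lambda\in\mathbb{R}$ the level set $\{s\in\mathbb{U}:f(s)\le\lambda\}$ is compact. A function $f:\mathbb{X}\times\mathbb{A}\to\mathbb{R}\cup\{+\infty\}$ is $\mathbb{K}$-inf-compact if for every nonempty compact $\mathcal{K}\subset\mathbb{X}$ the restriction of $f$ to $\mathcal{K}\times\mathbb{A}$ is inf-compact. A sequence $\{f_n\}_{n\ge1}$ of real-valued functions on a metric space $(\mathbb{S},\rho)$ is lower semi-equicontinuous on $\mathbb{S}$ if for each $s\in\mathbb{S}$ and each $\varepsilon>0$ there exists $\delta>0$ such that $f_n(s')>f_n(s)-\varepsilon$ for all $n\ge1$ whenever $\rho(s,s')<\delta$ (so assuming this property for $\{u_{\alpha_n}\}$ includes that these functions are real-valued). The sequence $\{u_{\alpha_n}\}$ of nonnegative functions is asymptotically uniformly integrable with respect to a probability measure $\mu$ on $\mathbb{X}$ if $\lim_{K\to+\infty}\limsup_{n\to\infty}\int_{\mathbb{X}}u_{\alpha_n}(z)\mathbf{1}\{u_{\alpha_n}(z)\ge K\}\,\mu(dz)=0$; equivalently, there exists $N\ge1$ such that $\{u_{\alpha_N},u_{\alpha_{N+1}},\dots\}$ is uniformly integrable with respect to $\mu$. *)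

(* Defs.v *)
From HB Require Import structures.
From mathcomp Require Import all_boot all_order all_algebra.
From mathcomp Require Import all_classical all_reals all_analysis.
From mathcomp Require Import measurable_realfun.

Set Implicit Arguments.
Unset Strict Implicit.
Unset Printing Implicit Defensive.

Import Order.TTheory GRing.Theory Num.Theory.
Import numFieldNormedType.Exports.

Local Open Scope classical_set_scope.
Local Open Scope ring_scope.
Local Open Scope ereal_scope.

HB.mixin Record isSeparable T & Topological T := {
  separable : exists2 D : set T, countable D & dense D }.

#[short(type="polishType")]
HB.structure Definition Polish (R : realType) :=
  {T of Metric R T & Complete T & isSeparable T}.

(* Nonemptiness is required because a measurableType is pointed. *)
Record borelSubset (R : realType) (P : polishType R) := BorelSubset {
  carrier : set P;
  carrier_borel : <<s (@open P) >> carrier;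
  carrier_nonempty : carrier !=set0 }.

(* A Borel subset seen as a space of its own, with the restricted metric and
   the Borel sigma-algebra of the induced topology. *)
Definition borelSpace (R : realType) (P : polishType R) (X : borelSubset P) :
  Type := set_type (carrier X).
Coercion borelSpace : borelSubset >-> Sortclass.

Section borel_space.
Context (R : realType) (P : polishType R) (X : borelSubset P).

Let borelSpace_point : borelSpace X :=
  SigSub (mem_set (svalP (cid (carrier_nonempty X)))).

HB.instance Definition _ := PseudoMetric.copy (borelSpace X)
  (set_type (carrier X)).
HB.instance Definition _ := isPointed.Build (borelSpace X) borelSpace_point.
HB.instance Definition _ := Measurable.copy (borelSpace X)
  (g_sigma_algebraType (@open (borelSpace X))).

End borel_space.

Section topological_notions.
Context (R : realType).

Definition inf_compact_on (S : topologicalType) (D : set S) (f : S -> \bar R) :=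
  forall lambda : R, compact (D `&` [set s | f s <= lambda%:E]).

Definition K_inf_compact (X A : topologicalType) (f : X * A -> \bar R) :=
  forall K : set X, K !=set0 -> compact K -> inf_compact_on (K `*` setT) f.

Definition weakly_continuous (T : topologicalType) (P : polishType R)
    (X : borelSubset P) (k : T -> {measure set X -> \bar R}) :=
  forall f : X -> R, continuous f ->
    (exists M : R, forall y, (`|f y| <= M)%R) ->
    forall p, \int[k p']_y (f y)%:E @[p' --> p] --> \int[k p]_y (f y)%:E.

Definition lower_semi_equicontinuous (S : pseudoMetricType R)
    (f : nat -> S -> R) :=
  forall (s : S) (e : R), (0 < e)%R ->
    exists2 delta : R, (0 < delta)%R &
      forall s', ball s delta s' -> forall n, (f n s' > f n s - e)%R.

Definition asymptotically_uniformly_integrable d (T : measurableType d)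
    (mu : {measure set T -> \bar R}) (f : nat -> T -> \bar R) :=
  (fun K : R => limn_esup (fun n =>
    \int[mu]_z (f n z * (\1_[set y | (K%:E <= f n y)%E] z)%:E))) @ +oo%R --> 0.

End topological_notions.

Section markov_decision_process.
Context (R : realType) d d' (X : measurableType d) (A : measurableType d').

Definition history t := (t.-tuple (X * A) * X)%type.

Definition policy := forall t, R.-pker (history t) ~> A.

(* Sequences of state-action pairs with the product sigma-algebra. *)
Definition trajectory := g_sigma_algebraType
  (\bigcup_t preimage_set_system setT (fun w : nat -> X * A => w t) measurable).

Definition state (t : nat) (w : trajectory) : X := (w t).1.
Definition action (t : nat) (w : trajectory) : A := (w t).2.
Definition past (t : nat) (w : trajectory) : t.-tuple (X * A) :=
  [tuple w i | i < t].
Definition history_at (t : nat) (w : trajectory) : history t :=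
  (past t w, state t w).

Variables (c : X * A -> \bar R) (q : R.-pker (X * A) ~> X).

(* P is the law of the trajectory when the process starts at x, actions are
   drawn from pi and transitions from q. By the Ionescu Tulcea theorem there is
   exactly one such P. *)
Record induced_measure (pi : policy) (x : X) (P : probability trajectory R) :
    Prop := {
  induced_initial : forall B, measurable B -> P (state 0 @^-1` B) = \d_x B;
  induced_action : forall t (C : set (history t)) (D : set A),
    measurable C -> measurable D ->
    P (history_at t @^-1` C `&` action t @^-1` D) =
    \int[P]_(w in history_at t @^-1` C) pi t (history_at t w) D;
  induced_state : forall t (C : set (t.+1.-tuple (X * A))) (B : set X),
    measurable C -> measurable B ->
    P (past t.+1 @^-1` C `&` state t.+1 @^-1` B) =
    \int[P]_(w in past t.+1 @^-1` C) q (state t w, action t w) B }.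

(* The Dirac mass is only the default value demanded by xget. *)
Definition policy_measure (pi : policy) (x : X) : probability trajectory R :=
  xget (@dirac _ trajectory point R : probability trajectory R)
    [set P | induced_measure pi x P].

Definition v_horizon (N : nat) (alpha : R) (pi : policy) (x : X) : \bar R :=
  \int[policy_measure pi x]_w
    \sum_(0 <= t < N) (alpha ^+ t)%:E * c (state t w, action t w).

Definition v_discounted (alpha : R) (pi : policy) (x : X) : \bar R :=
  \int[policy_measure pi x]_w
    \sum_(0 <= t <oo) (alpha ^+ t)%:E * c (state t w, action t w).

Definition v_opt (alpha : R) (x : X) : \bar R :=
  ereal_inf [set v_discounted alpha pi x | pi in [set: policy]].

Definition w_average (pi : policy) (x : X) : \bar R :=
  limn_esup (fun N => (N.+1%:R^-1)%:E * v_horizon N.+1 1%R pi x).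

Definition w_opt (x : X) : \bar R :=
  ereal_inf [set w_average pi x | pi in [set: policy]].

Definition w_star : \bar R := ereal_inf (range w_opt).

Definition m_disc (alpha : R) : \bar R := ereal_inf (range (v_opt alpha)).

Definition u_disc (alpha : R) (x : X) : \bar R := v_opt alpha x - m_disc alpha.

Definition u_liminf (alpha : nat -> R) (x : X) : \bar R :=
  limn_einf (fun n => u_disc (alpha n) x).

End markov_decision_process.

Definition is_minimum (R : realType) (S : set (\bar R)) (m : \bar R) :=
  S m /\ lbound S m.

(* Main.v *)
Require Import Defs.
From HB Require Import structures.
From mathcomp Require Import all_boot all_order all_algebra.
From mathcomp Require Import all_classical all_reals all_analysis.
From mathcomp Require Import measurable_realfun.
From mathcomp Require Import ring lra.

(** The discounted problems are solved first, for nonnegative costs. Value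
    iteration, V_0 = 0 and
    V_(n+1)(x) = min_a [c(x,a) + alpha * int V_n dq(.|x,a)], increases to a
    limit V. Weak continuity of q and K-inf-compactness of c keep every V_n
    lower semicontinuous, make the minima attained, and let the minimum over a
    commute with the increasing limit, so that V solves the same equation. V
    lies below the cost of every policy because V_n lies below the cost of n
    stages, and a measurable selection of minimizers is a stationary policy that
    costs at most V. Hence V = v_alpha, and with u_alpha = v_alpha - m_alpha
      (1 - alpha) m_alpha + u_alpha(x)
        = min_a [c(x,a) + alpha * int u_alpha dq(.|x,a)].
    See [discounted_optimality_equation].

    Then alpha = alpha_n tends to 1. For the inequality
    min_a [c + int u dq] <= w* + u, lower semi-equicontinuity makes
    U_N = inf_(n >= N) u_(alpha_n) lower semicontinuous; U_N increases to u, and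
    because of this monotonicity the argument that gave the fixed point of value
    iteration applies again ([K_inf_compact_limit]). It yields
    min_a [c + int u dq] <= w + u for every w such that
    (1 - alpha_n) m_(alpha_n) is infinitely often below w + e, for each e > 0.
    A stationary policy of minimizers then has average cost at most w, so
    w* <= w ([average_cost_inequality]). Together with the Tauberian inequality
    limsup (1 - alpha_n) m_(alpha_n) <= w*, this shows that
    (1 - alpha_n) m_(alpha_n) converges to w*.

    For the opposite inequality the action is fixed in the discounted equation:
    asymptotic uniform integrability and pointwise convergence bound the limit
    of int u_(alpha_n) dq(.|x,a) by int u dq(.|x,a).

    All this speaks of expectations under policies, hence of the existence of
    the law of the trajectory ([ionescu_tulcea], [policy_measureP]). A cost
    bounded below is reduced to a nonnegative one by adding a constant, which
    leaves u unchanged and moves w* by that constant. *)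

Set Implicit Arguments.
Unset Strict Implicit.
Unset Printing Implicit Defensive.

Import Order.TTheory GRing.Theory Num.Theory.
Import numFieldNormedType.Exports.

Local Open Scope classical_set_scope.
Local Open Scope ring_scope.
Local Open Scope ereal_scope.

(** * Extension of a consistent family of finite-horizon laws *)

Section chains.
Context d (W : measurableType d) (R : realType) (K : nat -> R.-pker W ~> W).

(** The law of the configuration after the steps s, ..., s+N-1, started from w.
    The starting step is a parameter because countable subadditivity is proved
    by following conditional probabilities given the first s steps, for all s. *)
Fixpoint run (N s : nat) : R.-spker W ~> W :=
  if N is N'.+1 then mkcomp_noparam (K s) (run N' s.+1)
  else kdirac (@measurable_id _ W setT).

Lemma run0 s w B : run 0 s w B = \d_w B.
Proof. by []. Qed.

Lemma runS N s w B : run N.+1 s w B = \int[K s w]_v run N s.+1 v B.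
Proof. by []. Qed.

Lemma integral_runS N s w f : (forall v, 0 <= f v) ->
  measurable_fun [set: W] f ->
  \int[run N.+1 s w]_v f v = \int[K s w]_u \int[run N s.+1 u]_v f v.
Proof.
by move=> f0 mf; rewrite -(integral_kcomp (K s) (kernel.kernel_snd (run N s.+1))).
Qed.

(** The recursion defining [run] peels off the first step, whereas conditioning
    on the past of a step needs the last one. *)
Lemma integral_run_last N s w f : (forall v, 0 <= f v) ->
  measurable_fun [set: W] f ->
  \int[run N.+1 s w]_v f v = \int[run N s w]_u \int[K (s + N) u]_v f v.
Proof.
move=> f0 mf.
have mKf t : measurable_fun [set: W] (fun u => \int[K t u]_v f v).
  by apply: measurable_fun_integral_kernel => // U mU; exact: measurable_kernel.
elim: N s w => [|N IH] s w.
  rewrite integral_runS// addn0 integral_dirac//.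
    rewrite diracT mul1e; apply: eq_integral => u _.
    by rewrite integral_dirac// diracT mul1e.
rewrite integral_runS// [RHS]integral_runS//; last first.
  by move=> u; exact: integral_ge0.
by apply: eq_integral => u _; rewrite IH addSnnS.
Qed.

Variable agree : nat -> W -> W -> Prop.
Hypothesis agree_sym : forall n v w, agree n v w -> agree n w v.
Hypothesis agree_le : forall m n v w, (m <= n)%N -> agree n v w -> agree m v w.
Hypothesis agree_glue : forall u : nat -> W,
  (forall n, agree n (u n) (u n.+1)) -> exists w, forall n, agree n (u n) w.
Hypothesis K_agree : forall n w (f g : W -> \bar R),
  (forall v, 0 <= f v) -> (forall v, 0 <= g v) ->
  measurable_fun [set: W] f -> measurable_fun [set: W] g ->
  (forall v, agree n w v -> f v <= g v) ->
  \int[K n w]_v f v <= \int[K n w]_v g v.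

(** The events decided by the first n steps. The relation [agree n] stands for
    the coincidence of two configurations in their first n steps, which avoids
    any coordinates here. *)
Definition known n (B : set W) := forall v w, agree n v w -> B v -> B w.

Definition cylinder (B : set W) := measurable B /\ exists n, known n B.

Lemma known_le m n B : (m <= n)%N -> known m B -> known n B.
Proof. by move=> mn kB v w /(agree_le mn); exact: kB. Qed.

(** A step does not disturb what is decided before it; both inequalities come
    from [K_agree], applied to the indicator and to a constant. *)
Lemma K_known n w B : measurable B -> known n B -> K n w B = \d_w B.
Proof.
move=> mB kB.
have mi : measurable_fun [set: W] (fun v => (\1_B v)%:E : \bar R).
  by apply/measurable_EFinP; exact: measurable_indic.
have i0 v : 0 <= (\1_B v)%:E :> \bar R by rewrite lee_fin.
have eqB v : agree n w v -> \1_B v = \1_B w :> R.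
  move=> wv; rewrite !indicE; congr (_ %:R); congr nat_of_bool.
  apply/idP/idP => /set_mem Bx; apply/mem_set.
    by apply: kB Bx; exact: agree_sym.
  exact: kB Bx.
have -> : K n w B = \int[K n w]_v (\1_B v)%:E by rewrite integral_indic// setIT.
have -> : \d_w B = \int[K n w]_v (\1_B w)%:E.
  by rewrite integral_cst// prob_kernel mule1 diracE indicE.
have mc : measurable_fun [set: W] (cst (\1_B w)%:E : W -> \bar R).
  exact: measurable_cst.
by apply/eqP; rewrite eq_le; apply/andP; split; apply: K_agree => // v /eqB ->.
Qed.

Lemma run_known N s w B : measurable B -> known s B -> run N s w B = \d_w B.
Proof.
move=> mB; elim: N s w => [|N IH] s w kB; first exact: run0.
rewrite runS (eq_integral (fun v => \d_v B)); last first.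
  by move=> v _; apply: IH; exact: known_le kB.
rewrite -(K_known w mB kB); transitivity (\int[K s w]_v (\1_B v)%:E).
  by apply: eq_integral => v _; rewrite diracE indicE.
by rewrite integral_indic// setIT.
Qed.

(** Consistency of the finite-horizon laws. *)
Lemma run_split N M s w B : measurable B -> known (s + N)%N B ->
  run (N + M) s w B = run N s w B.
Proof.
move=> mB; elim: N s w => [|N IH] s w kB.
  by rewrite add0n run_known ?run0// -(addn0 s).
by rewrite addSn !runS; apply: eq_integral => v _; rewrite IH// addSnnS.
Qed.

(** The sequence is constant from the level of B on; the upper limit is used
    because it is nonnegative for every set B, as a content requires. *)
Definition premeasure (B : set W) (w : W) : \bar R := limn_esup (fun n => run n 0 w B).

Lemma premeasureE n B w : measurable B -> known n B ->
  premeasure B w = run n 0 w B.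
Proof.
move=> mB kB.
rewrite /premeasure.
suff /cvg_limn_einf_sup[_ ->] : run m 0 w B @[m --> \oo] --> run n 0 w B by [].
apply: cvg_near_cst; exists n => // m /= nm.
by rewrite -(subnKC nm) run_split.
Qed.

Lemma cylinder0 : cylinder set0.
Proof. by split => //; exists 0%N. Qed.

Lemma cylinderU : setU_closed cylinder.
Proof.
move=> A B [mA [a kA]] [mB [b kB]]; split; first exact: measurableU.
exists (maxn a b) => v w vw; case=> [Av|Bv]; [left|right].
  exact: (known_le (leq_maxl a b) kA) Av.
exact: (known_le (leq_maxr a b) kB) Bv.
Qed.

Lemma cylinderC : setC_closed cylinder.
Proof.
move=> A [mA [a kA]]; split; first exact: measurableC.
by exists a => v w vw nAv Aw; apply: nAv; apply: kA Aw; exact: agree_sym.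
Qed.

(** A copy of W, to carry the algebra of cylinders next to the sigma-algebra of
    W. *)
Definition cylinder_space : Type := W.
Fact cylinder_display : measure_display. Proof. exact: default_measure_display. Qed.
HB.instance Definition _ := Pointed.on cylinder_space.
HB.instance Definition _ := isAlgebraOfSets.Build cylinder_display cylinder_space
  cylinder0 cylinderU cylinderC.

Variable w0 : W.
Let mu (B : set cylinder_space) : \bar R := premeasure B w0.


Let mu_ge0 B : 0 <= mu B.
Proof. by apply: limf_esup_ge0 => // n; exact: measure_ge0. Qed.

Let muE n B : measurable (B : set W) -> known n B -> mu B = run n 0 w0 B.
Proof. exact: premeasureE. Qed.

Let mu_semi_additive : measure_function.semi_additive mu.
Proof.
move=> F n mF tF [mUF _].
have [l kl] := choice (fun k => (mF k).2).
pose N := (\max_(k < n) l k)%N.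
have kF (k : nat) : (k < n)%N -> known N (F k).
  move=> kn; apply: known_le (kl k); exact: (leq_bigmax (Ordinal kn)).
have kU : known N (\big[setU/set0]_(k < n) F k).
  move=> v w vw; rewrite -!bigcup_mkord => -[k /= kn Fv].
  by exists k => //; exact: kF Fv.
rewrite (muE mUF kU) measure_semi_additive//; last by move=> k; exact: (mF k).1.
by apply: eq_bigr => -[k kn] _; rewrite (muE (mF k).1 (kF _ kn)).
Qed.

HB.instance Definition _ := isContent.Build _ _ R mu mu_ge0 mu_semi_additive.


(** If the probabilities of the F k summed to less than that of A, then, given
    the first step, the same strict inequality would hold between conditional
    probabilities for some outcome of that step, because otherwise integration
    would contradict it. Repeating this for ever yields a configuration w along
    which the inequality holds after every number of steps. After sufficiently
    many steps the conditional probabilities of A and of any given F k are 0 or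
    1 according to w, so that w lies in A and in no F k. *)
Let mu_sigma_subadditive : measurable_subset_sigma_subadditive mu.
Proof.
move=> A F mF [mA [a kA]] AF.
have [l kl] := choice (fun k => (mF k).2).
have {}mF k : measurable (F k : set W) := (mF k).1.
(* conditional probability, given s steps that led to w, of a set B of level m *)
pose val m s w (B : set W) := run (m - s) s w B.
have val_ge0 m s w B : 0 <= val m s w B by exact: measure_ge0.
have val_dirac m s w B : measurable B -> known m B -> (m <= s)%N ->
    val m s w B = \d_w B.
  by move=> mB kB ms; rewrite /val run_known//; exact: known_le kB.
have valS m s w B : measurable B -> known m B ->
    val m s w B = \int[K s w]_v val m s.+1 v B.
  move=> mB kB; have [sm|ms] := ltnP s m; first by rewrite /val -(subnSK sm) runS.
  rewrite val_dirac// -(run_known 1 w mB (known_le ms kB)) runS.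
  by apply: eq_integral => v _; rewrite val_dirac// (leq_trans ms).
have mval m s B : measurable B -> measurable_fun setT (fun w => val m s w B).
  by move=> mB; exact: measurable_kernel.
pose good s w := \sum_(k <oo) val (l k) s w (F k) < val a s w A.
rewrite leNgt; apply/negP => lt0.
have good0 : good 0%N w0.
  move: lt0; rewrite (muE mA kA) /good /val subn0.
  by under eq_eseriesr do rewrite (muE (mF _) (kl _)) -(subn0 (l _)).
have step s w : exists v, good s w -> agree s w v /\ good s.+1 v.
  have [gw|ngw] := pselect (good s w); last by exists w.
  apply: contrapT => nv; move: gw; apply/negP; rewrite -leNgt.
  rewrite valS//; under eq_eseriesr do rewrite valS//.
  rewrite -integral_nneseries//; last by move=> n; exact: mval.
  apply: K_agree => //.
  - by move=> v; exact: nneseries_ge0.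
  - exact: mval.
  - by apply: ge0_emeasurable_sum => // k _; exact: mval.
  - by move=> v wv; rewrite leNgt; apply/negP => gv; apply: nv; exists v.
have [nxt nxtP] := choice (fun p : nat * W => step p.1 p.2).
pose u := fix u n := if n is n.+1 then nxt (n, u n) else w0.
have gu n : good n (u n).
  by elim: n => [//|n IH]; exact: (nxtP (n, u n) IH).2.
have [w uw] := agree_glue (fun n => (nxtP (n, u n) (gu n)).1).
have Aw : A w.
  apply: (kA _ _ (uw a)); apply: contrapT => nA.
  have := gu a; rewrite /good (val_dirac a)// diracE memNset//=.
  by apply/negP; rewrite -leNgt; exact: nneseries_ge0.
have [k _ Fw] := AF _ Aw.
pose N := maxn a (l k).
have := gu N; rewrite /good (val_dirac a)//; last exact: leq_maxl.
apply/negP; rewrite -leNgt; apply: (@le_trans _ _ (val (l k) N (u N) (F k))).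
  rewrite val_dirac//; last exact: leq_maxr.
  rewrite [leRHS]diracE mem_set; first by rewrite diracE lee_fin; case: (_ \in _).
  apply: kl (Fw); apply: agree_sym.
  by apply: agree_le (uw N); exact: leq_maxr.
apply: le_trans (nneseries_lim_ge k.+1 _) => //.
by rewrite big_nat_recr//= leeDr// sume_ge0.
Qed.

HB.instance Definition _ :=
  Content_SigmaSubAdditive_isMeasure.Build _ R cylinder_space mu
  mu_sigma_subadditive.

Hypothesis cylinder_generates : @measurable _ W `<=` <<s cylinder >>.

(** The Ionescu Tulcea extension theorem for step kernels K n on a space W of
    configurations: Caratheodory extension of the content given by the
    finite-horizon laws on the algebra of cylinders. *)
Theorem ionescu_tulcea : exists P : probability W R,
  forall n B, measurable B -> known n B -> P B = run n 0 w0 B.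
Proof.
pose m := measure_extension (mu : {measure set cylinder_space -> \bar R}).
have mid : measurable_fun [set: g_sigma_algebraType (@measurable _ cylinder_space)]
    (id : _ -> W).
  by move=> _ B /cylinder_generates mB; rewrite setTI.
have mT : m setT = 1.
  transitivity (mu setT); first by apply: measurable_mu_extE; exact: measurableT.
  by rewrite (@muE 0%N)// run0 diracT.
pose m1 := HB.pack_for
  (probability (g_sigma_algebraType (@measurable _ cylinder_space)) R)
  m (Measure_isProbability.Build _ _ _ m mT).
pose id1 := HB.pack_for
  {mfun g_sigma_algebraType (@measurable _ cylinder_space) >-> W}
  (id : g_sigma_algebraType (@measurable _ cylinder_space) -> W)
  (isMeasurableFun.Build _ _ _ _ _ mid).
exists (distribution m1 id1) => n B mB kB.
rewrite -(muE mB kB) /distribution/= /pushforward preimage_id.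
by apply: measurable_mu_extE; split => //; exists n.
Qed.

End chains.

(** * The law of the trajectory under a policy *)

Lemma ge0_integral_eq_law d d' (W : measurableType d) (Y : measurableType d')
    (R : realType) (mu nu : {measure set W -> \bar R}) (g : W -> Y)
    (h : Y -> \bar R) :
  measurable_fun setT g -> measurable_fun setT h -> (forall y, 0 <= h y) ->
  (forall C, measurable C -> mu (g @^-1` C) = nu (g @^-1` C)) ->
  \int[mu]_w h (g w) = \int[nu]_w h (g w).
Proof.
move=> mg mh h0 eqC; have hi (m : {measure set W -> \bar R}) :
    \int[m]_w h (g w) = \int[pushforward m g]_y h y.
  by rewrite ge0_integral_pushforward// => y _.
rewrite !hi; apply: eq_measure_integral => // C mC _; exact: eqC.
Qed.

Section kernel_substitution.
Context d d' d'' (W : measurableType d) (Y : measurableType d')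
  (Z : measurableType d'') (R : realType).

Definition precomp_kernel (f : {mfun W >-> Y}) (k : R.-pker Y ~> Z) (w : W) :
  {measure set Z -> \bar R} := k (f w).

Let precomp_kernel_measurable f k U : measurable U ->
  measurable_fun [set: W] (precomp_kernel f k ^~ U).
Proof.
by move=> mU; exact: (measurableT_comp (measurable_kernel k U mU)).
Qed.

HB.instance Definition _ f k :=
  isKernel.Build _ _ _ _ R (precomp_kernel f k) (@precomp_kernel_measurable f k).

Let precomp_kernel_prob f k w : precomp_kernel f k w setT = 1.
Proof. exact: prob_kernel. Qed.

HB.instance Definition _ f k :=
  Kernel_isProbability.Build _ _ _ _ R (precomp_kernel f k) (@precomp_kernel_prob f k).

(** The law of g (w, y) when y is drawn from k w. *)
Definition image_kernel (k : R.-pker W ~> Y) (g : {mfun (W * Y)%type >-> Z})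
    (w : W) :
  {measure set Z -> \bar R} :=
  mkcomp k (kdirac (measurable_funP g)) w.

Let image_kernel_measurable k g U : measurable U ->
  measurable_fun [set: W] (image_kernel k g ^~ U).
Proof. by move=> mU; exact: measurable_kernel. Qed.

HB.instance Definition _ k g :=
  isKernel.Build _ _ _ _ R (image_kernel k g) (@image_kernel_measurable k g).

Lemma integral_image_kernel k g w f : (forall z, 0 <= f z) -> measurable_fun setT f ->
  \int[image_kernel k g w]_z f z = \int[k w]_y f (g (w, y)).
Proof.
move=> f0 mf; rewrite integral_kcomp//; apply: eq_integral => y _.
by rewrite integral_dirac// diracT mul1e.
Qed.

Let image_kernel_prob k g w : image_kernel k g w setT = 1.
Proof.
rewrite -[LHS]mul1e -integral_cst// integral_image_kernel//.
by rewrite integral_cst// prob_kernel mule1.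
Qed.

HB.instance Definition _ k g :=
  Kernel_isProbability.Build _ _ _ _ R (image_kernel k g) (@image_kernel_prob k g).

End kernel_substitution.

Section trajectories.
Context (R : realType) d d' (X : measurableType d) (A : measurableType d').
Local Notation W := (trajectory X A).

Lemma measurable_coord t : measurable_fun [set: W] (fun w : W => (w t : X * A)).
Proof.
move=> _ B mB; rewrite setTI; apply: sub_sigma_algebra; exists t => //.
by exists B => //; rewrite setTI.
Qed.

Lemma measurable_state t : measurable_fun [set: W] (@state _ _ X A t).
Proof. exact: measurableT_comp (measurable_coord t). Qed.

Lemma measurable_action t : measurable_fun [set: W] (@action _ _ X A t).
Proof. exact: measurableT_comp (measurable_coord t). Qed.

Lemma measurable_past t : measurable_fun [set: W] (@past _ _ X A t).
Proof.
apply/measurable_fun_tnthP => i.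
by rewrite (_ : _ \o _ = fun w : W => w i); [exact: measurable_coord
  |apply/funext => w /=; rewrite tnth_mktuple].
Qed.

Lemma measurable_history_at t : measurable_fun [set: W] (@history_at _ _ X A t).
Proof.
by apply: measurable_fun_pair; [exact: measurable_past|exact: measurable_state].
Qed.

Lemma measurable_trajectory d'' (T : measurableType d'') (f : T -> W) :
  (forall t, measurable_fun setT (fun z => f z t : X * A)) ->
  measurable_fun setT f.
Proof.
move=> mf; apply: measurability => //.
move=> _ [_ [t _ [B mB <-]] <-]; rewrite !setTI.
by rewrite -[X in measurable X]setTI; exact: mf.
Qed.

Definition set_state t (p : W * X) : W :=
  fun i => if i == t then (p.2, (p.1 t).2) else p.1 i.

Definition set_action t (p : W * A) : W :=
  fun i => if i == t then ((p.1 t).1, p.2) else p.1 i.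

Lemma measurable_set_state t : measurable_fun setT (set_state t).
Proof.
apply: measurable_trajectory => i; rewrite /set_state; case: (i == t).
  apply: measurable_fun_pair => //.
  by apply: (measurableT_comp (measurable_action t)).
by apply: (measurableT_comp (measurable_coord i)).
Qed.

Lemma measurable_set_action t : measurable_fun setT (set_action t).
Proof.
apply: measurable_trajectory => i; rewrite /set_action; case: (i == t).
  apply: measurable_fun_pair => //.
  by apply: (measurableT_comp (measurable_state t)).
by apply: (measurableT_comp (measurable_coord i)).
Qed.

HB.instance Definition _ t :=
  isMeasurableFun.Build _ _ _ _ _ (measurable_set_state t).
HB.instance Definition _ t :=
  isMeasurableFun.Build _ _ _ _ _ (measurable_set_action t).
HB.instance Definition _ t :=
  isMeasurableFun.Build _ _ _ _ (@history_at _ _ X A t) (@measurable_history_at t).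

Definition coord t (w : W) : X * A := w t.
HB.instance Definition _ t :=
  isMeasurableFun.Build _ _ _ _ (coord t) (measurable_coord t).

Variables (q : R.-pker (X * A) ~> X) (pi : policy R X A) (x : X).

Definition next_state t : R.-pker W ~> X :=
  if t is t'.+1 then precomp_kernel (coord t') q else kdirac (measurable_cst x).

(** States and actions are revealed alternately, so that every step draws from
    a single kernel that is given, q or a decision rule. A step overwrites one
    half of a coordinate of the trajectory and keeps the rest. *)
Definition trajectory_kernel s : R.-pker W ~> W :=
  if odd s then
    (image_kernel (precomp_kernel (@history_at _ _ X A s./2) (pi s./2))
      (set_action s./2)
      : R.-pker W ~> W)
  else (image_kernel (next_state s./2) (set_state s./2) : R.-pker W ~> W).

(** State t is drawn at step 2t and action t at step 2t+1, so that s steps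
    determine the states of index below s/2 rounded up and the actions of index
    below s/2 rounded down. *)
Definition agree s (v w : W) := forall t,
  ((t.*2 < s)%N -> state t v = state t w) /\
  ((t.*2.+1 < s)%N -> action t v = action t w).

Lemma agree_sym s v w : agree s v w -> agree s w v.
Proof. by move=> vw t; have [s1 s2] := vw t; split=> ts; rewrite ?s1 ?s2. Qed.

Lemma agree_trans s u v w : agree s u v -> agree s v w -> agree s u w.
Proof.
move=> uv vw t; have [uv1 uv2] := uv t; have [vw1 vw2] := vw t.
by split=> ts; rewrite ?uv1 ?uv2 ?vw1 ?vw2.
Qed.

Lemma agree_le m n v w : (m <= n)%N -> agree n v w -> agree m v w.
Proof.
move=> mn vw t; have [vw1 vw2] := vw t.
by split=> tm; [apply: vw1|apply: vw2]; exact: leq_trans mn.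
Qed.

(** Step t of the limit trajectory is read off from members of the sequence
    that come late enough for it to be settled. *)
Lemma agree_glue (u : nat -> W) : (forall n, agree n (u n) (u n.+1)) ->
  exists w, forall n, agree n (u n) w.
Proof.
move=> uS; have {}uS m k : agree m (u m) (u (m + k)%N).
  elim: k => [|k IH]; first by rewrite addn0.
  by apply: agree_trans IH _; rewrite addnS; apply: agree_le (uS _); exact: leq_addr.
exists (fun t => (state t (u t.*2.+1), action t (u t.*2.+2))) => n t.
split => tn; rewrite -(subnKC tn); symmetry.
  by apply: (uS _ _ t).1.
by apply: (uS _ _ t).2.
Qed.

Lemma agree_set_state t w y : agree t.*2 w (set_state t (w, y)).
Proof.
move=> i; rewrite /state /action /set_state/=; case: eqVneq => [->|//].
by rewrite ltnn ltnNge leqnSn.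
Qed.

Lemma agree_set_action t w y : agree t.*2.+1 w (set_action t (w, y)).
Proof.
move=> i; rewrite /state /action /set_action/=; case: eqVneq => [->|//].
by rewrite ltnn.
Qed.

Lemma integral_trajectory_kernel_even t w f : (forall z, 0 <= f z) ->
  measurable_fun setT f ->
  \int[trajectory_kernel t.*2 w]_z f z =
  \int[next_state t w]_y f (set_state t (w, y)).
Proof.
by move=> f0 mf; rewrite /trajectory_kernel odd_double doubleK integral_image_kernel.
Qed.

Lemma integral_trajectory_kernel_odd t w f : (forall z, 0 <= f z) ->
  measurable_fun setT f ->
  \int[trajectory_kernel t.*2.+1 w]_z f z =
  \int[pi t (history_at t w)]_a f (set_action t (w, a)).
Proof.
move=> f0 mf; rewrite /trajectory_kernel oddS odd_double/= uphalf_double.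
by rewrite integral_image_kernel.
Qed.

Lemma trajectory_kernel_agree n w (f g : W -> \bar R) :
  (forall v, 0 <= f v) -> (forall v, 0 <= g v) ->
  measurable_fun [set: W] f -> measurable_fun [set: W] g ->
  (forall v, agree n w v -> f v <= g v) ->
  \int[trajectory_kernel n w]_v f v <= \int[trajectory_kernel n w]_v g v.
Proof.
move=> f0 g0 mf mg fg; rewrite -(odd_double_half n).
have [on|en] := boolP (odd n).
  rewrite !integral_trajectory_kernel_odd//; apply: ge0_le_integral => //.
  - apply: (measurableT_comp mf).
    exact: (measurableT_comp (measurable_set_action _) (pair1_measurable _)).
  - apply: (measurableT_comp mg).
    exact: (measurableT_comp (measurable_set_action _) (pair1_measurable _)).
  - move=> a _; apply: fg; rewrite -{1}(odd_double_half n) on.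
    exact: agree_set_action.
rewrite add0n !integral_trajectory_kernel_even//; apply: ge0_le_integral => //.
- apply: (measurableT_comp mf).
  exact: (measurableT_comp (measurable_set_state _) (pair1_measurable _)).
- apply: (measurableT_comp mg).
  exact: (measurableT_comp (measurable_set_state _) (pair1_measurable _)).
- move=> a _; apply: fg; rewrite -{1}(odd_double_half n) (negbTE en).
  exact: agree_set_state.
Qed.

Lemma agree_coord t v w : agree t.+1.*2 v w -> v t = w t.
Proof.
move=> /(_ t)[s a]; rewrite (surjective_pairing (v t)) (surjective_pairing (w t)).
by congr pair; [apply: s|apply: a]; rewrite doubleS.
Qed.

Lemma cylinder_generates : @measurable _ W `<=` <<s cylinder agree >>.
Proof.
apply: smallest_sub; first exact: smallest_sigma_algebra.
move=> _ [t _ [B mB <-]]; apply: sub_sigma_algebra; split.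
  by apply: sub_sigma_algebra; exists t => //; exists B.
exists t.+1.*2 => v w vw; rewrite !setTI /=.
by rewrite (agree_coord vw).
Qed.


Local Notation K := trajectory_kernel.

Variables (P : probability W R) (w0 : W).
Hypothesis Prun : forall n B, measurable B -> known agree n B ->
  P B = run K n 0 w0 B.

(** The law of the trajectory disintegrates along its last relevant step. *)
Lemma trajectory_law_last n B : measurable B -> known agree n.+1 B ->
  P B = \int[run K n 0 w0]_u K n u B.
Proof.
move=> mB kB; rewrite (Prun mB kB).
transitivity (\int[run K n.+1 0 w0]_v (\1_B v)%:E).
  by rewrite integral_indic// setIT.
rewrite integral_run_last//; last first.
  by apply/measurable_EFinP; exact: measurable_indic.
by apply: eq_integral => u _; rewrite integral_indic// setIT add0n.
Qed.

(** Equality on cylinders passes to integrals of functions of the first n steps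
    through their image measures. *)
Lemma integral_trajectory_law n d'' (Y : measurableType d'') (g : W -> Y) h :
  measurable_fun setT g -> measurable_fun setT h -> (forall y, 0 <= h y) ->
  (forall v w, agree n v w -> g v = g w) ->
  \int[P]_w h (g w) = \int[run K n 0 w0]_w h (g w).
Proof.
move=> mg mh h0 gn; apply: ge0_integral_eq_law => // C mC; apply: Prun.
  by rewrite -[X in measurable X]setTI; exact: mg.
by move=> v w /gn /= ->.
Qed.

Lemma agree_past t v w : agree t.*2 v w -> past t v = past t w.
Proof.
move=> vw; apply: eq_from_tnth => i; rewrite !tnth_mktuple.
by apply: agree_coord; apply: agree_le vw; rewrite leq_double ltn_ord.
Qed.

Lemma agree_history_at t v w : agree t.*2.+1 v w ->
  history_at t v = history_at t w.
Proof.
move=> vw; congr pair; first by apply: agree_past; apply: agree_le vw.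
exact: (vw t).1.
Qed.

Lemma known_preimage n T (g : W -> T) (C : set T) :
  (forall v w, agree n v w -> g v = g w) -> known agree n (g @^-1` C).
Proof. by move=> gn v w /gn /= ->. Qed.

Lemma known_setI n (B C : set W) :
  known agree n B -> known agree n C -> known agree n (B `&` C).
Proof. by move=> kB kC v w vw [Bv Cv]; split; [exact: kB Bv|exact: kC Cv]. Qed.

Let mpre d'' (Y : measurableType d'') (g : W -> Y) (C : set Y) :
  measurable_fun setT g -> measurable C -> measurable (g @^-1` C).
Proof. by move=> mg mC; rewrite -[X in measurable X]setTI; exact: mg. Qed.

Lemma trajectory_law_initial B : measurable B -> P (state 0 @^-1` B) = \d_x B.
Proof.
move=> mB; have mS : measurable (@state _ _ X A 0 @^-1` B).
  by apply: mpre => //; exact: measurable_state.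
rewrite (@trajectory_law_last 0)//; last first.
  by apply: known_preimage => v w /(_ 0%N)[->].
rewrite integral_dirac//; last exact: measurable_kernel.
rewrite diracT mul1e.
have -> : K 0 w0 (state 0 @^-1` B) =
    \int[K 0.*2 w0]_w (\1_(state 0 @^-1` B) w)%:E.
  by rewrite integral_indic// setIT.
rewrite integral_trajectory_kernel_even//; last first.
  by apply/measurable_EFinP; exact: measurable_indic.
transitivity (\int[\d_x]_y (\1_B y)%:E : \bar R).
  by apply: eq_integral => y _; rewrite !indicE.
by rewrite integral_indic// setIT.
Qed.

Lemma trajectory_law_action t (C : set (history X A t)) (D : set A) :
  measurable C -> measurable D ->
  P (history_at t @^-1` C `&` action t @^-1` D) =
  \int[P]_(w in history_at t @^-1` C) pi t (history_at t w) D.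
Proof.
move=> mC mD.
have mH := mpre (@measurable_history_at t) mC.
have mB : measurable (history_at t @^-1` C `&` action t @^-1` D : set W).
  by apply: measurableI => //; apply: mpre => //; exact: measurable_action.
rewrite (@trajectory_law_last t.*2.+1)//; last first.
  apply: known_setI; apply: known_preimage => v w vw.
    by apply: agree_history_at; apply: agree_le vw.
  exact: (vw t).2.
pose h := (fun p => pi t p D) \_ C.
have -> : \int[P]_(w in history_at t @^-1` C) pi t (history_at t w) D =
    \int[P]_w h (history_at t w).
  by rewrite integral_mkcond; apply: eq_integral => w _; rewrite /h /patch.
rewrite (@integral_trajectory_law t.*2.+1); first last.
- exact: agree_history_at.
- by move=> p; rewrite /h /patch; case: ifP.
- apply: (measurable_restrictT _ mC).1; apply: measurable_funTS.
  exact: (measurable_kernel (pi t) _ mD).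
- exact: measurable_history_at.
apply: eq_integral => w _.
transitivity (\int[K t.*2.+1 w]_v
    (\1_(history_at t @^-1` C `&` action t @^-1` D) v)%:E).
  by rewrite integral_indic// setIT.
rewrite integral_trajectory_kernel_odd//; last first.
  by apply/measurable_EFinP; exact: measurable_indic.
rewrite (eq_integral (fun a => (\1_C (history_at t w))%:E * (\1_D a)%:E)); last first.
  move=> a _; rewrite -EFinM -natrM mulnb; congr ((nat_of_bool _)%:R%:E).
  rewrite in_setI; congr andb.
    change ((history_at t (set_action t (w, a)) \in C) = (history_at t w \in C)).
    by rewrite (agree_history_at (@agree_set_action t w a)).
  change ((action t (set_action t (w, a)) \in D) = (a \in D)).
  by rewrite /action /set_action/= eqxx.
rewrite ge0_integralZl//; last by apply/measurable_EFinP; exact: measurable_indic.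
rewrite integral_indic// setIT /h /patch indicE; case: ifP => _.
  by rewrite mul1e.
by rewrite mul0e.
Qed.

Lemma trajectory_law_state t (C : set (t.+1.-tuple (X * A))) (B : set X) :
  measurable C -> measurable B ->
  P (past t.+1 @^-1` C `&` state t.+1 @^-1` B) =
  \int[P]_(w in past t.+1 @^-1` C) q (state t w, action t w) B.
Proof.
move=> mC mB.
have mH := mpre (@measurable_past t.+1) mC.
have mE : measurable (past t.+1 @^-1` C `&` state t.+1 @^-1` B : set W).
  by apply: measurableI => //; apply: mpre => //; exact: measurable_state.
rewrite (@trajectory_law_last t.+1.*2)//; last first.
  apply: known_setI; apply: known_preimage => v w vw.
    by apply: agree_past; apply: agree_le vw.
  exact: (vw t.+1).1.
pose h := (fun p => q (tnth p ord_max) B) \_ C.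
have hE w : q (state t w, action t w) B = q (tnth (past t.+1 w) ord_max) B.
  by rewrite tnth_mktuple/= -surjective_pairing.
have -> : \int[P]_(w in past t.+1 @^-1` C) q (state t w, action t w) B =
    \int[P]_w h (past t.+1 w).
  by rewrite integral_mkcond; apply: eq_integral => w _; rewrite /h /patch -hE.
rewrite (@integral_trajectory_law t.+1.*2); first last.
- exact: agree_past.
- by move=> p; rewrite /h /patch; case: ifP.
- apply: (measurable_restrictT _ mC).1; apply: measurable_funTS.
  exact: measurableT_comp (measurable_kernel q _ mB) (measurable_tnth _).
- exact: measurable_past.
apply: eq_integral => w _.
transitivity (\int[K t.+1.*2 w]_v
    (\1_(past t.+1 @^-1` C `&` state t.+1 @^-1` B) v)%:E).
  by rewrite integral_indic// setIT.
rewrite integral_trajectory_kernel_even//; last first.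
  by apply/measurable_EFinP; exact: measurable_indic.
rewrite (eq_integral (fun y => (\1_C (past t.+1 w))%:E * (\1_B y)%:E)); last first.
  move=> y _; rewrite -EFinM -natrM mulnb; congr ((nat_of_bool _)%:R%:E).
  rewrite in_setI; congr andb.
    change ((past t.+1 (set_state t.+1 (w, y)) \in C) = (past t.+1 w \in C)).
    by rewrite (agree_past (@agree_set_state t.+1 w y)).
  change ((state t.+1 (set_state t.+1 (w, y)) \in B) = (y \in B)).
  by rewrite /state /set_state/= eqxx.
rewrite ge0_integralZl//; last by apply/measurable_EFinP; exact: measurable_indic.
rewrite integral_indic// setIT /h /patch indicE; case: ifP => _.
  by rewrite mul1e tnth_mktuple.
by rewrite mul0e.
Qed.

End trajectories.

Lemma induced_measure_exists (R : realType) d d' (X : measurableType d)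
    (A : measurableType d') (q : R.-pker (X * A) ~> X) (pi : policy R X A) x :
  exists P : probability (trajectory X A) R, induced_measure q pi x P.
Proof.
have [P Prun] := ionescu_tulcea (@agree_sym _ _ X A) (@agree_le _ _ X A)
  (@agree_glue _ _ X A) (@trajectory_kernel_agree R _ _ X A q pi x) point
  (@cylinder_generates _ _ X A).
exists P; split.
- exact: trajectory_law_initial Prun.
- exact: trajectory_law_action Prun.
- exact: trajectory_law_state Prun.
Qed.

Lemma policy_measureP (R : realType) d d' (X : measurableType d)
    (A : measurableType d') (q : R.-pker (X * A) ~> X) (pi : policy R X A) x :
  induced_measure q pi x (policy_measure q pi x).
Proof. exact: xgetPex (induced_measure_exists q pi x). Qed.

(** * Compactness and lower semicontinuity *)

Section sequential_compactness.
Context (R : realType) (T : pseudoMetricType R).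

(** Sequences are needed because K-inf-compactness only controls level sets
    above compact sets, such as a convergent sequence with its limit. *)
Lemma closure_seq (S : set T) (x : T) : closure S x ->
  exists2 u : nat -> T, (forall n, S (u n)) & u @ \oo --> x.
Proof.
move=> Sx.
have H n : exists y, S y /\ ball x (n.+1%:R^-1 : R)%R y.
  by have [|y [Sy By]] := Sx (ball x (n.+1%:R^-1)%R); [exact: nbhsx_ballx|exists y].
have [u uP] := choice H; exists u => [n|]; first exact: (uP n).1.
apply/cvg_ballP => e e0; near=> n.
apply: le_ball (uP n).2.
by apply: ltW; near: n; exact: (near_infty_natSinv_lt (PosNum e0)).
Unshelve. all: by end_near. Qed.

End sequential_compactness.

(** A filter on this set that does not cluster at x lives on finitely many of
    the u n. *)
Lemma compact_cvg_range (T : topologicalType) (u : nat -> T) (x : T) :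
  u @ \oo --> x -> compact (x |` range u).
Proof.
move=> ux F FF Fux; have [xF|] := pselect (cluster F x).
  by exists x; split => //; left.
move=> /existsNP[B /existsNP[C /not_implyP[FB /not_implyP[xC BC]]]].
have [N _ uN] := ux _ xC.
pose I := u @` `I_N.
have cI : compact I.
  by apply: finite_compact; apply: finite_image; exact: finite_II.
have FI : F I.
  apply: filterS (filterI FB Fux) => z [Bz [zx|[n _ unz]]].
    by exfalso; apply: BC; exists z; split => //; rewrite zx; exact: nbhs_singleton.
  exists n => //; rewrite /= ltnNge; apply/negP => Nn; apply: BC; exists z.
  by split => //; rewrite -unz; exact: uN.
have [y [[n nN uny] Fy]] := cI F FF FI; exists y; split => //.
by right; exists n.
Qed.

Lemma nested_compact (T : topologicalType) (D : nat -> set T) :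
  (forall n, compact (D n)) -> (forall n, closed (D n)) ->
  (forall n, D n !=set0) -> (forall n, D n.+1 `<=` D n) ->
  exists x, forall n, D n x.
Proof.
move=> cD clD D0 DS; have [u uD] := choice D0.
have Dmono m k : D (m + k)%N `<=` D m.
  by elim: k => [|k IH]; rewrite ?addn0// addnS => z /DS/IH.
have Du k : (u @ \oo) (D k).
  by exists k => // n /= kn; apply: (Dmono k (n - k)%N); rewrite subnKC.
have [x [_ xu]] := cD 0%N (u @ \oo) _ (Du 0%N).
exists x => n; apply: clD => B xB.
by have := xu _ _ (Du n) xB.
Qed.

Lemma lower_semicontinuous_closed (R : realType) (T : topologicalType)
    (f : T -> \bar R) : lower_semicontinuous f <->
  forall a : R, closed [set x | f x <= a%:E].
Proof.
rewrite lower_semicontinuousP; split=> H a.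
  have -> : [set x | f x <= a%:E] = ~` [set x | a%:E < f x].
    by apply/seteqP; split => x /=; rewrite leNgt => /negP.
  exact: open_closedC.
have -> : [set x | a%:E < f x] = ~` [set x | f x <= a%:E].
  by apply/seteqP; split => x /=; rewrite ltNge => /negP.
exact: closed_openC.
Qed.

Lemma lower_semicontinuousD (R : realType) (T : topologicalType)
    (f g : T -> \bar R) : (forall x, 0 <= f x) -> (forall x, 0 <= g x) ->
  lower_semicontinuous f -> lower_semicontinuous g ->
  lower_semicontinuous (fun x => f x + g x).
Proof.
move=> f0 g0 lf lg x a afg.
have : exists r s : R, [/\ (a < r + s)%R, r%:E < f x \/ (r < 0)%R
    & s%:E < g x \/ (s < 0)%R].
  move: (f0 x) (g0 x) afg; case: (f x) => [r| |]//; case: (g x) => [s| |]//.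
  - move=> _ _; rewrite -EFinD lte_fin => ars; pose e := ((r + s - a) / 3)%R.
    exists (r - e)%R, (s - e)%R; rewrite /e; split; [lra|left|left];
      by rewrite lte_fin; lra.
  - by exists (-1)%R, (a + 2)%R; split; [lra|right; lra|left; exact: ltry].
  - by exists (a + 2)%R, (-1)%R; split; [lra|left; exact: ltry|right; lra].
  - by exists (a + 2)%R, (-1)%R; split; [lra|left; exact: ltry|right; lra].
case=> r [s [ars rf sg]].
have [U xU Uf] : exists2 V, nbhs x V & forall y, V y -> r%:E < f y.
  case: rf => [/lf//|r0]; exists setT => [|y _]; first exact: filterT.
  by apply: lt_le_trans (f0 y); rewrite lte_fin.
have [V xV Vg] : exists2 V, nbhs x V & forall y, V y -> s%:E < g y.
  case: sg => [/lg//|s0]; exists setT => [|y _]; first exact: filterT.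
  by apply: lt_le_trans (g0 y); rewrite lte_fin.
exists (U `&` V) => [|y [/Uf fy /Vg gy]]; first exact: filterI.
by apply: lt_trans (lteD fy gy); rewrite lte_fin.
Qed.

Lemma lower_semicontinuousZ (R : realType) (T : topologicalType) (r : R)
    (f : T -> \bar R) : (0 <= r)%R -> lower_semicontinuous f ->
  lower_semicontinuous (fun x => r%:E * f x).
Proof.
rewrite le_eqVlt => /predU1P[<- _ x a|r0 lf x a].
  by rewrite mul0e => a0; exists setT => [|y _]; [exact: filterT|rewrite mul0e].
have E y : (a%:E < r%:E * f y) = ((a / r)%:E < f y).
  have {1}-> : a = (r * (a / r))%R by rewrite mulrC divfK// gt_eqF.
  by rewrite (EFinM r (a / r)%R) lte_pmul2l ?lte_fin.
by rewrite E => /lf[V xV aV]; exists V => // y /aV; rewrite E.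
Qed.

(** Stated for a function that is only approached from below, so that pointwise
    suprema over any index type are covered. *)
Lemma lower_semicontinuous_sup (R : realType) (T : topologicalType) I
    (f : I -> T -> \bar R) (g : T -> \bar R) :
  (forall i, lower_semicontinuous (f i)) -> (forall i x, f i x <= g x) ->
  (forall x a, a%:E < g x -> exists i, a%:E < f i x) ->
  lower_semicontinuous g.
Proof.
move=> lf fg gf x a /gf[i /lf[V xV aV]].
by exists V => // y /aV /lt_le_trans; apply.
Qed.

(** * Lower semicontinuous functions under weakly continuous kernels *)

Section borel_space_topology.
Context (R : realType) (P : polishType R) (X : borelSubset P).
Implicit Types x y z : X.

Definition dist x y : R := mdist (set_val x) (set_val y).

Lemma ball_dist x e y : ball x e y = (dist x y < e)%R :> Prop.
Proof. by rewrite [LHS](_ : _ = ball (set_val x) e (set_val y))// ballEmdist. Qed.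

Lemma borel_space_hausdorff : hausdorff_space X.
Proof.
rewrite ball_hausdorff => x y xy.
have d0 : (0 < dist x y)%R.
  rewrite mdist_gt0; apply: contra_neq xy => /eqP; rewrite (inj_eq val_inj).
  by move/eqP.
have e0 : (0 < dist x y / 2)%R by rewrite divr_gt0.
exists (PosNum e0, PosNum e0) => /=; apply/eqP; rewrite -subset0.
move=> z [xz /ball_sym yz]; have := ball_triangle xz yz.
by rewrite -splitr ball_dist ltxx.
Qed.

Lemma borel_lower_semicontinuous_measurable (f : X -> \bar R) :
  lower_semicontinuous f -> measurable_fun setT f.
Proof.
move=> lf; apply: (measurability _ (ErealGenOInfty.measurableE R)).
move=> /= _ [_ [a ->]] <-; rewrite setTI; apply: sub_sigma_algebra.
by rewrite preimage_itvoy; move/lower_semicontinuousP : lf; exact.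
Qed.

Section lipschitz_regularization.
Variable V : X -> \bar R.
Hypotheses (V0 : forall y, 0 <= V y) (lV : lower_semicontinuous V).

Definition truncation k y : R := fine (mine (V y) k%:R%:E).

(** The Pasch-Hausdorff envelope: the largest k-Lipschitz function below the
    truncation of V at k. *)
Definition lipschitz_reg k y : R :=
  inf [set (truncation k z + k%:R * dist y z)%R | z in [set: X]].

Lemma truncationE k y : (truncation k y)%:E = mine (V y) k%:R%:E.
Proof.
rewrite fineK// fin_numE; apply/andP; split.
  by rewrite gt_eqF// lt_min ltNyr andbT (lt_le_trans _ (V0 y))// ltNyr.
by rewrite lt_eqF// gt_min ltry orbT.
Qed.

Lemma truncation_ge0 k y : (0 <= truncation k y)%R.
Proof. by rewrite -lee_fin truncationE le_min V0 lee_fin ler0n. Qed.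

Lemma dist_ge0 x y : (0 <= dist x y)%R.
Proof. exact: mdist_ge0. Qed.

Lemma lipschitz_reg_ge k y a :
  (forall z, (a <= truncation k z + k%:R * dist y z)%R) ->
  (a <= lipschitz_reg k y)%R.
Proof.
move=> aP; apply: lb_le_inf; first by eexists; exists y.
by move=> _ [z _ <-].
Qed.

Lemma lipschitz_reg_le k y z :
  (lipschitz_reg k y <= truncation k z + k%:R * dist y z)%R.
Proof.
apply: ge_inf; last by exists z.
exists 0%R => _ [t _ <-]; rewrite addr_ge0 ?truncation_ge0//.
by rewrite mulr_ge0// dist_ge0.
Qed.

Lemma lipschitz_reg_ge0 k y : (0 <= lipschitz_reg k y)%R.
Proof.
apply: lipschitz_reg_ge => z; rewrite addr_ge0 ?truncation_ge0//.
by rewrite mulr_ge0// dist_ge0.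
Qed.

Lemma lipschitz_reg_le_trunc k y : (lipschitz_reg k y <= truncation k y)%R.
Proof.
apply: (le_trans (lipschitz_reg_le k y y)).
by rewrite [dist y y]mdistxx mulr0 addr0.
Qed.

Lemma lipschitz_reg_leV k y : (lipschitz_reg k y)%:E <= V y.
Proof.
apply: (@le_trans _ _ (truncation k y)%:E).
  by rewrite lee_fin lipschitz_reg_le_trunc.
by rewrite truncationE ge_min lexx.
Qed.

Lemma lipschitz_reg_lek k y : (lipschitz_reg k y <= k%:R)%R.
Proof.
apply: (le_trans (lipschitz_reg_le_trunc k y)).
by rewrite -lee_fin truncationE ge_min lexx orbT.
Qed.

Lemma lipschitz_reg_nd y : {homo lipschitz_reg ^~ y : m n / (m <= n)%N >-> (m <= n)%R}.
Proof.
move=> m n mn; apply: lipschitz_reg_ge => z.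
apply: (le_trans (lipschitz_reg_le m y z)); apply: lerD.
  rewrite -lee_fin !truncationE; apply: le_min2 => //.
  by rewrite lee_fin ler_nat.
by rewrite ler_wpM2r ?dist_ge0// ler_nat.
Qed.

Lemma lipschitz_reg_lipschitz k y z :
  (lipschitz_reg k y <= lipschitz_reg k z + k%:R * dist y z)%R.
Proof.
rewrite -lerBlDr; apply: lipschitz_reg_ge => t; rewrite lerBlDr.
apply: (le_trans (lipschitz_reg_le k y t)).
rewrite -addrA lerD2l -mulrDr ler_wpM2l// addrC.
exact: metric_triangle.
Qed.

Lemma lipschitz_reg_continuous k : continuous (lipschitz_reg k).
Proof.
move=> y; have FF := nbhs_filter y; apply/cvgrPdist_lt => e e0.
have d0 : (0 < e / k.+1%:R)%R by rewrite divr_gt0.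
apply: (@filterS _ _ FF (ball y (e / k.+1%:R)%R)) (nbhsx_ballx y _ d0) => z.
rewrite ball_dist => yz.
have zy : dist z y = dist y z by exact: metric_sym.
have := lipschitz_reg_lipschitz k y z; have := lipschitz_reg_lipschitz k z y.
rewrite zy => h1 h2.
have : (k%:R * dist y z < e)%R.
  apply: (@le_lt_trans _ _ (k.+1%:R * dist y z)%R).
    by rewrite ler_wpM2r ?dist_ge0// ler_nat.
  by rewrite mulrC -ltr_pdivlMr.
rewrite ltr_norml => h3; apply/andP; split; lra.
Qed.

(** Near y the function V exceeds a; farther than e from y the penalty exceeds
    a as soon as k >= a / e. *)
Lemma lipschitz_reg_sup y (a : R) : a%:E < V y ->
  exists k, (a <= lipschitz_reg k y)%R.
Proof.
move=> /lV[U]; rewrite -nbhs_ballE => -[e /= e0 yU] aU.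
have [a0|a0] := leP a 0%R.
  by exists 0%N; apply: le_trans a0 (lipschitz_reg_ge0 _ _).
(* k >= a lets the truncation exceed a, k * e >= a serves the points at
   distance at least e *)
pose k := (Num.truncn (Num.max a (a / e)%R)).+1.
have kM : (Num.max a (a / e)%R <= k%:R)%R.
  by apply: ltW; rewrite truncnS_gt.
have [ka kae] : (a <= k%:R /\ a / e <= k%:R)%R.
  by apply/andP; rewrite -ge_max.
exists k; apply: lipschitz_reg_ge => z.
have [yz|yz] := ltP (dist y z) e.
  rewrite -[leLHS]addr0 lerD ?mulr_ge0 ?dist_ge0//.
  rewrite -lee_fin truncationE le_min lee_fin ka andbT ltW// aU//.
  by apply: yU; rewrite ball_dist.
rewrite -[leLHS]add0r lerD ?truncation_ge0//.
apply: (@le_trans _ _ (k%:R * e)%R); last by rewrite ler_wpM2l.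
by rewrite -ler_pdivrMr.
Qed.

Lemma lipschitz_reg_cvg y : (lipschitz_reg k y)%:E @[k --> \oo] --> V y.
Proof.
have -> : V y = ereal_sup (range (fun k => (lipschitz_reg k y)%:E)).
  apply/eqP; rewrite eq_le; apply/andP; split; last first.
    by apply: ge_ereal_sup => _ [k _ <-]; exact: lipschitz_reg_leV.
  rewrite leNgt; apply/negP; set s := ereal_sup _ => sV.
  have ks k : (lipschitz_reg k y)%:E <= s by apply: ereal_sup_ubound; exists k.
  have [a sa aV] : exists2 a : R, s < a%:E & a%:E < V y.
    move: sV (ks 0%N); case: s {ks} => [s| |]//=; case: (V y) => [v| |]//.
      rewrite lte_fin => sv _; exists ((s + v) / 2)%R; rewrite lte_fin; lra.
    by move=> _ _; exists (s + 1)%R; [rewrite lte_fin; lra|exact: ltry].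
  have [k ak] := lipschitz_reg_sup aV.
  by have := le_lt_trans (ks k) sa; rewrite lte_fin ltNge ak.
apply: ereal_nondecreasing_cvgn => m n mn; rewrite lee_fin.
exact: lipschitz_reg_nd.
Qed.

End lipschitz_regularization.

(** V is an increasing limit of bounded Lipschitz functions, so its integral is
    a supremum of continuous functions of p. *)
Lemma integral_lower_semicontinuous (T : topologicalType)
    (k : T -> {measure set X -> \bar R}) (V : X -> \bar R) :
  weakly_continuous k -> (forall y, 0 <= V y) -> lower_semicontinuous V ->
  lower_semicontinuous (fun p => \int[k p]_y V y).
Proof.
move=> wk V0 lV.
have mV := borel_lower_semicontinuous_measurable lV.
have mh n : measurable_fun setT (fun y => (lipschitz_reg V n y)%:E).
  apply: borel_lower_semicontinuous_measurable => y a ay.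
  have : nbhs y (lipschitz_reg V n @^-1` [set r | (a < r)%R]).
    apply: (@lipschitz_reg_continuous V V0 n y); apply: open_nbhs_nbhs.
    by split => //=; exact: open_gt.
  by move=> yU; exists (lipschitz_reg V n @^-1` [set r | (a < r)%R]).
have h0 n y : 0 <= (lipschitz_reg V n y)%:E by rewrite lee_fin lipschitz_reg_ge0.
have nd y : nondecreasing_seq (fun n => (lipschitz_reg V n y)%:E).
  by move=> m n mn; rewrite lee_fin lipschitz_reg_nd.
apply: (@lower_semicontinuous_sup _ _ nat
  (fun n p => \int[k p]_y (lipschitz_reg V n y)%:E)).
- move=> n p a ap.
  have kp : \int[k p']_y (lipschitz_reg V n y)%:E @[p' --> p] -->
      \int[k p]_y (lipschitz_reg V n y)%:E.
    apply: wk; first exact: lipschitz_reg_continuous.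
    exists n%:R => y; rewrite ger0_norm; last exact: lipschitz_reg_ge0.
    exact: lipschitz_reg_lek.
  exists [set p' | a%:E < \int[k p']_y (lipschitz_reg V n y)%:E] => //.
  apply: (kp [set r | a%:E < r]); apply: open_nbhs_nbhs.
  by split => //; exact: open_ereal_gt_ereal.
- move=> n p; apply: ge0_le_integral => // y _; exact: lipschitz_reg_leV.
- move=> p a aV.
  have : \int[k p]_y (lipschitz_reg V n y)%:E @[n --> \oo] --> \int[k p]_y V y.
    have -> : \int[k p]_y V y = \int[k p]_y limn (fun n => (lipschitz_reg V n y)%:E).
      apply: eq_integral => y _; apply/esym/cvg_lim => //.
      exact: lipschitz_reg_cvg.
    by apply: cvg_monotone_convergence => // y _ m n mn; exact: nd.
  move=> /(_ [set r | a%:E < r])[].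
    by apply: open_nbhs_nbhs; split => //; exact: open_ereal_gt_ereal.
  by move=> N _ /(_ N (leqnn N)) aN; exists N.
Qed.

End borel_space_topology.

(** * K-inf-compact functions and their partial minima *)

Lemma hausdorff_prod (T U : topologicalType) :
  hausdorff_space T -> hausdorff_space U -> hausdorff_space (T * U)%type.
Proof.
move=> hT hU [p1 p2] [q1 q2] pq; congr pair.
- apply: hT => B C pB qC.
  have [||[z1 z2] /= [[Bz _] [Cz _]]] := pq (B `*` setT) (C `*` setT).
  + by exists (B, setT) => //; split => //; exact: filterT.
  + by exists (C, setT) => //; split => //; exact: filterT.
  by exists z1.
- apply: hU => B C pB qC.
  have [||[z1 z2] /= [[_ Bz] [_ Cz]]] := pq (setT `*` B) (setT `*` C).
  + by exists (setT, B) => //; split => //; exact: filterT.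
  + by exists (setT, C) => //; split => //; exact: filterT.
  by exists z2.
Qed.

Section K_inf_compactness.
Context (R : realType) (PX PA : polishType R).
Context (X : borelSubset PX) (A : borelSubset PA).
Implicit Types (x : X) (a : A) (c F g : X * A -> \bar R).

(** A convergent sequence of points has its first components in a compact set,
    above which the level set is compact, hence closed. *)
Lemma K_inf_compact_lower_semicontinuous c :
  K_inf_compact c -> lower_semicontinuous c.
Proof.
move=> Kc; apply/lower_semicontinuous_closed => l p /closure_seq[u cu up].
have u1 : (fst \o u) @ \oo --> p.1 by apply: cvg_comp up _; exact: cvg_fst.
pose K := p.1 |` range (fst \o u).
have K0 : K !=set0 by exists p.1; left.
have /compact_closed cl := Kc K K0 (compact_cvg_range u1) l.
have hXA : hausdorff_space (X * A)%type.
  by apply: hausdorff_prod; exact: borel_space_hausdorff.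
have [] // := closed_cvg _ (cl hXA) _ _ up.
by apply: nearW => n; split; [split => //; right; exists n|exact: cu].
Qed.

(** The level sets of c + g are closed subsets of those of c. *)
Lemma K_inf_compactD c g : K_inf_compact c -> (forall p, 0 <= g p) ->
  (forall p, 0 <= c p) -> lower_semicontinuous g ->
  K_inf_compact (fun p => c p + g p).
Proof.
move=> Kc g0 c0 lg K K0 cK l.
have lcg : lower_semicontinuous (fun p => c p + g p).
  by apply: lower_semicontinuousD => //; exact: K_inf_compact_lower_semicontinuous.
have cl := (iffLR (lower_semicontinuous_closed _) lcg) l.
suff -> : (K `*` setT) `&` [set s | c s + g s <= l%:E] =
    ((K `*` setT) `&` [set s | c s <= l%:E]) `&` [set s | c s + g s <= l%:E].
  by apply: compact_closedI => //; exact: Kc.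
apply/seteqP; split => [s [Ks cgs]|s [[Ks _] cgs]]; split => //; split => //=.
by apply: le_trans cgs; exact: leeDl.
Qed.

Lemma sublevel_section_compact F x l : K_inf_compact F ->
  compact [set a | F (x, a) <= l%:E].
Proof.
move=> KF.
have -> : [set a | F (x, a) <= l%:E] =
    snd @` (([set x] `*` setT) `&` [set s | F s <= l%:E]).
  apply/seteqP; split => [a Fa|a [[y b] /= [[-> _] Fb] <-//]].
  by exists (x, a).
apply: continuous_compact.
  by apply: continuous_subspaceT => p; exact: cvg_snd.
by apply: KF; [exists x|exact: compact_set1].
Qed.

Lemma sublevel_section_closed F x l : K_inf_compact F ->
  closed [set a | F (x, a) <= l%:E].
Proof.
move=> KF; apply: compact_closed; first exact: borel_space_hausdorff.
exact: sublevel_section_compact.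
Qed.

(** Above a convergent sequence with its limit, this set is the projection of a
    compact set. This is where K-inf-compactness, rather than compactness of
    the action space, suffices. *)
Lemma sublevel_projection_closed F (C : set A) l : K_inf_compact F -> closed C ->
  closed [set x | exists2 a, C a & F (x, a) <= l%:E].
Proof.
move=> KF cC x /closure_seq[u uS ux].
pose K := x |` range u.
have K0 : K !=set0 by exists x; left.
pose L := fst @` (((K `*` setT) `&` [set s | F s <= l%:E]) `&` (snd @^-1` C)).
have cL : closed L.
  apply: compact_closed; first exact: borel_space_hausdorff.
  apply: continuous_compact.
    by apply: continuous_subspaceT => p; exact: cvg_fst.
  apply: compact_closedI; first by apply: KF => //; exact: compact_cvg_range.
  by apply: closed_comp cC => p _; exact: cvg_snd.
have [] : L x.
  apply: closed_cvg cL _ _ ux; apply: nearW => n; have [a Ca Fa] := uS n.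
  by exists (u n, a) => //; split => //; split => //; split => //; right; exists n.
by move=> [y a] [[_ /= Fy] Ca] /= <-; exists a.
Qed.

(** Minimization over actions commutes with increasing limits: the sets of
    actions a in C with F k (x, a) <= b + 1/(k+1) are nested, nonempty and
    compact. It gives the attainment of minima (constant F), the fixed point of
    value iteration, and the vanishing discount limit. *)
Lemma K_inf_compact_limit (F : nat -> X * A -> \bar R) (C : set A) x (b : R) :
  (forall k, K_inf_compact (F k)) -> closed C ->
  (forall k p, F k p <= F k.+1 p) ->
  (forall k (e : R), (0 < e)%R -> exists2 a, C a & F k (x, a) <= (b + e)%:E) ->
  exists2 a, C a & forall k, F k (x, a) <= b%:E.
Proof.
move=> KF cC FS FC.
(* the slack 1/(k+1) makes D k nonempty and disappears in the limit *)
pose D k := [set a | F k (x, a) <= (b + k.+1%:R^-1)%:E] `&` C.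
have cD k : compact (D k).
  by apply: compact_closedI => //; exact: sublevel_section_compact.
have clD k : closed (D k).
  by apply: closedI => //; exact: sublevel_section_closed.
have D0 k : D k !=set0.
  by have [|a Ca Fa] := FC k (k.+1%:R^-1)%R; [by []|exists a].
have DS k : D k.+1 `<=` D k.
  move=> a [/= Fa Ca]; split => //=; apply: le_trans (FS _ _) (le_trans Fa _).
  by rewrite lee_fin lerD2l lef_pV2 ?posrE// ler_nat.
have [a Da] := nested_compact cD clD D0 DS.
exists a; first exact: (Da 0%N).2.
have Fmono k n : (k <= n)%N -> F k (x, a) <= F n (x, a).
  move=> /subnKC <-; elim: (n - k)%N => [|m IH]; first by rewrite addn0.
  by rewrite addnS; exact: le_trans IH (FS _ _).
move=> k; apply/lee_addgt0Pr => e e0; rewrite -EFinD.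
have [N _ Ne] := near_infty_natSinv_lt (PosNum e0).
apply: (le_trans (Fmono k (maxn k N) (leq_maxl _ _))).
apply: (le_trans (Da (maxn k N)).1); rewrite lee_fin lerD2l ltW//.
by apply: Ne; exact: leq_maxr.
Qed.

Definition section_inf F (C : set A) x : \bar R :=
  ereal_inf [set F (x, a) | a in C].

Lemma section_inf_attained F C x : K_inf_compact F -> (forall p, 0 <= F p) ->
  closed C -> section_inf F C x < +oo ->
  exists2 a, C a & F (x, a) = section_inf F C x.
Proof.
move=> KF F0 cC Foo.
have Fge0 : 0 <= section_inf F C x by apply: le_ereal_inf_tmp => _ [a _ <-].
have Fle a : C a -> section_inf F C x <= F (x, a).
  by move=> Ca; apply: ereal_inf_lbound; exists a.
move: Foo Fge0 Fle; case E : (section_inf F C x) => [b| |]// _ b0 Fle.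
have FC (k : nat) (e : R) : (0 < e)%R -> exists2 a, C a & F (x, a) <= (b + e)%:E.
  move=> e0; have : section_inf F C x < (b + e)%:E by rewrite E lte_fin ltrDl.
  by move=> /ereal_inf_lt[_ [a Ca <-]] /ltW; exists a.
have [//|a Ca Fa] := K_inf_compact_limit (fun=> KF) cC _ FC.
by exists a => //; apply/eqP; rewrite eq_le (Fa 0%N) Fle.
Qed.

Lemma section_inf_lower_semicontinuous F C : K_inf_compact F ->
  (forall p, 0 <= F p) -> closed C -> lower_semicontinuous (section_inf F C).
Proof.
move=> KF F0 cC; apply/lower_semicontinuous_closed => l.
have -> : [set x | section_inf F C x <= l%:E] =
    [set x | exists2 a, C a & F (x, a) <= l%:E].
  apply/seteqP; split => [x /= Fx|x [a Ca Fa]] /=.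
    have [|a Ca Fa] := @section_inf_attained F C x KF F0 cC.
      exact: le_lt_trans Fx (ltry _).
    by exists a => //; rewrite Fa.
  by apply: le_trans Fa; apply: ereal_inf_lbound; exists a.
exact: sublevel_projection_closed.
Qed.

Lemma measurable_section_inf F C : K_inf_compact F ->
  (forall p, 0 <= F p) -> closed C -> measurable_fun setT (section_inf F C).
Proof.
move=> KF F0 cC; apply: borel_lower_semicontinuous_measurable.
exact: section_inf_lower_semicontinuous.
Qed.

Definition minimizers F x : set A := [set a | forall b, F (x, a) <= F (x, b)].

(** Some minimizer lies in C exactly if the minimum over C equals the minimum
    over all actions, and both minima are lower semicontinuous in x. *)
Lemma measurable_minimizers_meet F C : K_inf_compact F -> (forall p, 0 <= F p) ->
  (forall x, exists a, F (x, a) < +oo) -> closed C ->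
  measurable [set x | minimizers F x `&` C !=set0].
Proof.
move=> KF F0 Foo cC.
have Tle x b : section_inf F setT x <= F (x, b).
  by apply: ereal_inf_lbound; exists b.
have -> : [set x | minimizers F x `&` C !=set0] =
    setT `&` [set x | section_inf F C x <= section_inf F setT x].
  rewrite setTI; apply/seteqP; split => x /=.
    move=> [a [Fa Ca]]; apply: (@le_trans _ _ (F (x, a))).
      by apply: ereal_inf_lbound; exists a.
    by apply: le_ereal_inf_tmp => _ [b _ <-].
  move=> Cx; have [b Fb] := Foo x.
  have [|a Ca Fa] := @section_inf_attained F C x KF F0 cC.
    exact: le_lt_trans Cx (le_lt_trans (Tle x b) Fb).
  by exists a; split => // d; rewrite Fa (le_trans Cx).
by apply: measurable_lee => //; apply: measurable_section_inf => //; exact: closedT.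
Qed.

Lemma minimizers_compact F x : K_inf_compact F -> (forall p, 0 <= F p) ->
  (exists a, F (x, a) < +oo) ->
  [/\ compact (minimizers F x), closed (minimizers F x) & minimizers F x !=set0].
Proof.
move=> KF F0 [b Fb].
have Tle a : section_inf F setT x <= F (x, a).
  by apply: ereal_inf_lbound; exists a.
have [|a _ Fa] := @section_inf_attained F setT x KF F0 closedT.
  exact: le_lt_trans (Tle b) Fb.
have aoo : F (x, a) < +oo by rewrite Fa (le_lt_trans (Tle b)).
have [l Fl] : exists l, F (x, a) = l%:E.
  by move: (F0 (x, a)) aoo; case: (F (x, a)) => // l _ _; exists l.
have -> : minimizers F x = [set d | F (x, d) <= l%:E].
  apply/seteqP; split => [d /(_ a)|d Fd e]; first by rewrite Fl.
  by apply: le_trans Fd _; rewrite -Fl Fa.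
split; [exact: sublevel_section_compact|exact: sublevel_section_closed|].
by exists a; rewrite /= Fl.
Qed.

End K_inf_compactness.

(** * Measurable selection of minimizers *)

Definition least (Q : nat -> Prop) : nat :=
  xget 0%N [set i | Q i /\ forall j, (j < i)%N -> ~ Q j].

Lemma leastP (Q : nat -> Prop) : (exists i, Q i) ->
  forall i, least Q = i <-> Q i /\ forall j, (j < i)%N -> ~ Q j.
Proof.
move=> [n Qn].
have exQ : exists i, `[< Q i >] by exists n; apply/asboolP.
have [] : [set i | Q i /\ forall j, (j < i)%N -> ~ Q j] (least Q).
  apply: (xgetPex 0%N).
  case: (ex_minnP exQ) => m /asboolP Qm mmin; exists m; split => // j jm Qj.
  by have := mmin j (asboolT Qj); rewrite leqNgt jm.
move=> Ql lmin i; split=> [<-//|[Qi imin]].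
apply/eqP; rewrite eqn_leq; apply/andP; split; rewrite leqNgt; apply/negP => lt.
  exact: lmin lt Qi.
exact: imin lt Ql.
Qed.

Section measurable_selection.
Context (R : realType) (PX PA : polishType R).
Context (X : borelSubset PX) (A : borelSubset PA).

(** Closed balls of radius 1/(k+1) around a dense sequence of the ambient
    Polish space; the subspace A need not contain the centres. *)
Lemma fine_closed_covers : exists C : nat -> nat -> set A,
  [/\ forall k i, closed (C k i), forall k a, exists i, C k i a &
  forall a U, open U -> U a -> exists k, forall i, C k i a -> C k i `<=` U].
Proof.
have [D cD dD] := @separable R PA.
have [p Dp] : D !=set0.
  have [|p [_ Dp]] := dD setT _ openT; last by exists p.
  by exists (set_val (point : A)).
have [D0|[d]] := pfcard_geP cD; first by move: Dp; rewrite D0.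
have dD' : forall y, D y -> exists i : nat, d i = y.
  move=> y Dy; have [i _ <-] := 'surj_d Dy; by exists i.
pose e k : R := (k.+1%:R^-1)%R.
have e0 k : (0 < e k)%R by rewrite /e invr_gt0.
exists (fun k i => [set a | (mdist (set_val a) (d i) <= e k)%R]); split.
- move=> k i a aC; rewrite /= leNgt; apply/negP => ed.
  have r0 : (0 < mdist (set_val a) (d i) - e k)%R by rewrite subr_gt0.
  have [b [/= Cb]] := aC _ (nbhsx_ballx a _ r0).
  rewrite ball_dist /dist => ab.
  have := metric_triangle (set_val a) (set_val b) (d i); lra.
- move=> k a; have [y [ay Dy]] : ball (set_val a) (e k) `&` D !=set0.
    have [||y [Oy Dy]] := dD (ball (set_val a) (e k))^° _ _.
    + by exists (set_val a); exact: nbhsx_ballx.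
    + exact: open_interior.
    by exists y; split => //; exact: interior_subset Oy.
  have [i di] := dD' y Dy; exists i => /=.
  by move: ay; rewrite ballEmdist/= di => /ltW.
- move=> a U oU Ua.
  have : nbhs a U by apply: open_nbhs_nbhs; split.
  rewrite -nbhs_ballE => -[r /= r0 rU].
  have [k _ kr] := near_infty_natSinv_lt (PosNum (divr_gt0 r0 (ltr0n R 2))).
  exists k => i /= Ca b /= Cb; apply: rU; rewrite ball_dist.
  have := metric_triangle (set_val a) (d i) (set_val b).
  rewrite (metric_sym (d i)) => /le_lt_trans; apply.
  have /= := kr k (leqnn k); rewrite -/(e k) => ekr; lra.
Qed.

(** At stage k, the first ball of the k-th cover is chosen that meets the
    minimizers left over from the previous stages. The sets so obtained are
    nested, compact and shrink to one minimizer phi x. The sequence of chosen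
    indices is a measurable function of x with countably many values, and
    whether phi x lies in a given open set can be read off from finitely many
    indices. *)
Theorem measurable_minimizer (F : X * A -> \bar R) :
  K_inf_compact F -> (forall p, 0 <= F p) -> (forall x, exists a, F (x, a) < +oo) ->
  exists phi : {mfun X >-> A}, forall x a, F (x, phi x) <= F (x, a).
Proof.
move=> KF F0 Foo.
have [C [cC covC fineC]] := fine_closed_covers.
(* s lists the indices chosen so far, one for each cover *)
pose Cs (s : seq nat) : set A :=
  [set a | forall j, (j < size s)%N -> C j (nth 0%N s j) a].
have CsS s i : Cs (rcons s i) = Cs s `&` C (size s) i.
  apply/seteqP; split=> [a Csa|a [Csa Ca]].
    split => [j js|].
      by have := Csa j; rewrite size_rcons nth_rcons js ltnS (ltnW js); apply.
    by have := Csa (size s); rewrite size_rcons nth_rcons ltnn eqxx leqnn; apply.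
  move=> j; rewrite size_rcons nth_rcons ltnS leq_eqVlt.
  by case: (ltngtP j (size s)) => //= [js _|-> _]; [exact: Csa|].
have cCs s : closed (Cs s).
  have -> : Cs s = \bigcap_(j in `I_(size s)) C j (nth 0%N s j).
    by apply/seteqP; split=> a h j /=; exact: h.
  by apply: closed_bigI => j _; exact: cC.
pose good x s := minimizers F x `&` Cs s !=set0.
have mgood s : measurable [set x | good x s] by exact: measurable_minimizers_meet.
pose I := fix I k x : seq nat := if k is k.+1 then
  rcons (I k x) (least (fun i => good x (rcons (I k x) i))) else [::].
have IS k x : exists i, I k.+1 x = rcons (I k x) i by eexists.
have sizeI k x : size (I k x) = k by elim: k => //= k IH; rewrite size_rcons IH.
have goodex x s : good x s -> exists i, good x (rcons s i).
  move=> [a [Fa Ca]]; have [i Ci] := covC (size s) a.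
  by exists i, a; split => //; rewrite CsS.
have goodI k x : good x (I k x).
  elim: k => [|k IH] /=; last exact: ((leastP (goodex _ _ IH) _).1 erefl).1.
  by have [_ _ [a Fa]] := minimizers_compact KF F0 (Foo x); exists a.
have mI k s : measurable [set x | I k x = s].
  elim: k s => [|k IH] s /=.
    have [<-|/eqP s0] := eqVneq [::] s.
      by rewrite (_ : [set _ | _] = setT)//; apply/seteqP.
    by rewrite (_ : [set _ | _] = set0)//; apply/seteqP; split.
  case/lastP: s => [|s i].
    rewrite (_ : [set _ | _] = set0)//; apply/seteqP; split => // x /=.
    by case: (I k x).
  have -> : [set x | rcons (I k x) (least (fun i => good x (rcons (I k x) i))) =
      rcons s i] = [set x | I k x = s] `&` ([set x | good x (rcons s i)] `&`
        \bigcap_(j in `I_i) ~` [set x | good x (rcons s j)]).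
    apply/seteqP; split=> x /=.
      move=> /rcons_inj[Is]; have := goodI k x; rewrite Is => gs.
      by move=> /(leastP (goodex _ _ gs))[].
    move=> [Is gi]; have := goodI k x; rewrite Is => gs; congr rcons.
    by apply/(leastP (goodex _ _ gs)).
  apply: measurableI => //; apply: measurableI => //.
  apply: fin_bigcap_measurable => // j _; exact: measurableC.
have nested x : exists a, forall k, (minimizers F x `&` Cs (I k x)) a.
  have [cM clM _] := minimizers_compact KF F0 (Foo x).
  apply: nested_compact => [k|k|k|k].
  - exact: compact_closedI.
  - exact: closedI.
  - exact: goodI.
  - by have [i ->] := IS k x; rewrite CsS => a [Ma [Ca _]].
have [phi phiP] := choice nested.
have mphi : measurable_fun setT phi.
  apply: measurability => // _ [U oU <-]; rewrite setTI.
  have -> : phi @^-1` U = \bigcup_k \bigcup_(s in [set s | Cs s `<=` U])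
      [set x | I k x = s].
    apply/seteqP; split=> [x /= Ux|x [k _ [s sU Ixs]]]; last first.
      by apply: sU; rewrite -Ixs; exact: (phiP x k).2.
    have [k kU] := fineC _ _ oU Ux; exists k.+1 => //; exists (I k.+1 x) => //.
    have := (phiP x k.+1).2; have [i ->] := IS k x; rewrite /mkset CsS sizeI.
    by move=> [_ /kU CU] a [_ /CU].
  apply: bigcupT_measurable => k; rewrite bigcup_mkcond.
  apply: countable_bigcupT_measurable; first exact: countableP.
  by move=> s; case: ifP.
pose Phi := HB.pack_for {mfun X >-> A} phi (isMeasurableFun.Build _ _ _ _ _ mphi).
by exists Phi => x a; exact: (phiP x 0%N).1.
Qed.

End measurable_selection.

(** * Expectations under a policy *)

Section policy_expectations.
Context (R : realType) d d' (X : measurableType d) (A : measurableType d').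
Local Notation W := (trajectory X A).
Variables (q : R.-pker (X * A) ~> X).
Implicit Types (pi : policy R X A) (x : X) (phi : {mfun X >-> A}).

Lemma expectation_initial pi x (f : X -> \bar R) :
  measurable_fun setT f -> (forall y, 0 <= f y) ->
  \int[policy_measure q pi x]_w f (state 0 w) = f x.
Proof.
move=> mf f0; have [init _ _] := policy_measureP q pi x.
transitivity (\int[\d_x]_y f y); last by rewrite integral_dirac// diracT mul1e.
have -> : \int[policy_measure q pi x]_w f (state 0 w) =
    \int[pushforward (policy_measure q pi x) (state 0)]_y f y.
  by rewrite ge0_integral_pushforward//; exact: measurable_state.
apply: eq_measure_integral => [|? C mC _]; first exact: measurable_state.
exact: init.
Qed.

(** Both sides integrate f against the same law of the state at time t+1: the
    defining identity of that law is the equality of the two measures. *)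
Lemma expectation_next pi x t (f : X -> \bar R) :
  measurable_fun setT f -> (forall y, 0 <= f y) ->
  \int[policy_measure q pi x]_w f (state t.+1 w) =
  \int[policy_measure q pi x]_w \int[q (state t w, action t w)]_y f y.
Proof.
move=> mf f0; have [_ _ next] := policy_measureP q pi x.
set P := policy_measure q pi x in next *.
have mg : measurable_fun [set: W] (fun w => (state t w, action t w) : X * A).
  by apply: measurable_fun_pair; [exact: measurable_state|exact: measurable_action].
pose g := HB.pack_for {mfun W >-> (X * A)%type}
  (fun w : W => (state t w, action t w) : X * A) (isMeasurableFun.Build _ _ _ _ _ mg).
pose l : R.-pker unit ~> W := kprobability (measurable_cst (P : pprobability W R)).
pose k := kernel.kernel_snd (T0 := unit) (precomp_kernel g q).
have -> : \int[P]_w f (state t.+1 w) = \int[pushforward P (state t.+1)]_y f y.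
  by rewrite ge0_integral_pushforward//; exact: measurable_state.
transitivity (\int[kcomp l k tt]_y f y); last by rewrite integral_kcomp.
apply: eq_measure_integral => [|? C mC _]; first exact: measurable_state.
have := next t setT C measurableT mC; rewrite preimage_setT setTI; exact.
Qed.

Definition stationary_policy phi : policy R X A := fun t =>
  kdirac (measurableT_comp (measurable_funP phi) measurable_snd).

(** The laws of (state, action) and of (state, phi state) agree on rectangles,
    hence everywhere. *)
Lemma expectation_stationary phi x t (f : X * A -> \bar R) :
  measurable_fun setT f -> (forall p, 0 <= f p) ->
  \int[policy_measure q (stationary_policy phi) x]_w f (state t w, action t w) =
  \int[policy_measure q (stationary_policy phi) x]_w
    f (state t w, phi (state t w)).
Proof.
move=> mf f0; have [_ act _] := policy_measureP q (stationary_policy phi) x.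
set P := policy_measure q (stationary_policy phi) x in act *.
have mS : measurable_fun [set: W] (@state _ _ X A t) by exact: measurable_state.
have mA : measurable_fun [set: W] (@action _ _ X A t) by exact: measurable_action.
have m1 : measurable_fun [set: W] (fun w => (state t w, action t w) : X * A).
  exact: measurable_fun_pair.
have m2 : measurable_fun [set: W] (fun w => (state t w, phi (state t w)) : X * A).
  by apply: measurable_fun_pair => //; exact: measurableT_comp.
have rect B D : measurable B -> measurable D ->
    P ((fun w => (state t w, action t w)) @^-1` (B `*` D)) =
    P ((fun w => (state t w, phi (state t w))) @^-1` (B `*` D)).
  move=> mB mD.
  have mE : measurable (state t @^-1` B : set W).
    by rewrite -[X in measurable X]setTI; exact: mS.
  have := act t (setT `*` B) D (measurableX measurableT mB) mD.
  have -> : history_at t @^-1` (setT `*` B) = state t @^-1` B :> set W.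
    by apply/seteqP; split => w // [].
  have -> : (fun w : W => (state t w, action t w)) @^-1` (B `*` D) =
      state t @^-1` B `&` action t @^-1` D by [].
  move=> ->.
  have -> : (fun w : W => (state t w, phi (state t w))) @^-1` (B `*` D) =
      (phi \o state t) @^-1` D `&` state t @^-1` B.
    by apply/seteqP; split => w [].
  rewrite -integral_indic//.
    by rewrite -[X in measurable X]setTI; exact: measurableT_comp.
pose m1' := HB.pack_for {mfun W >-> (X * A)%type}
  (fun w : W => (state t w, action t w) : X * A) (isMeasurableFun.Build _ _ _ _ _ m1).
pose m2' := HB.pack_for {mfun W >-> (X * A)%type}
  (fun w : W => (state t w, phi (state t w)) : X * A)
  (isMeasurableFun.Build _ _ _ _ _ m2).
transitivity (\int[distribution P m1']_p f p).
  by rewrite ge0_integral_pushforward.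
transitivity (\int[distribution P m2']_p f p); last first.
  by rewrite ge0_integral_pushforward.
apply: eq_measure_integral => C mC _.
apply: (measure_unique [set B `*` D | B in measurable & D in measurable]
  (fun=> setT)) => //.
- exact: measurable_prod_measurableType.
- move=> _ _ [B1 mB1 [D1 mD1 <-]] [B2 mB2 [D2 mD2 <-]]; rewrite -setXI.
  exists (B1 `&` B2); first exact: measurableI.
  by exists (D1 `&` D2) => //; exact: measurableI.
- by move=> _; exists setT => //; exists setT => //; rewrite setXTT.
- by rewrite bigcup_const.
- by move=> _ [B mB [D mD <-]]; exact: rect.
- move=> _; apply: le_lt_trans (ltry 1); exact: probability_le1.
Qed.

End policy_expectations.

(** * Telescoping the Bellman operator along a trajectory *)

Section costs.
Context (R : realType) d d' (X : measurableType d) (A : measurableType d').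
Local Notation W := (trajectory X A).
Variables (c : X * A -> \bar R) (q : R.-pker (X * A) ~> X).
Hypotheses (mc : measurable_fun setT c) (c0 : forall p, 0 <= c p).
Implicit Types (pi : policy R X A) (x : X) (phi : {mfun X >-> A}).

Definition stage_cost pi x t : \bar R :=
  \int[policy_measure q pi x]_w c (state t w, action t w).

Lemma stage_cost_ge0 pi x t : 0 <= stage_cost pi x t.
Proof. exact: integral_ge0. Qed.

Lemma measurable_state_action t :
  measurable_fun [set: W] (fun w => (state t w, action t w) : X * A).
Proof.
by apply: measurable_fun_pair; [exact: measurable_state|exact: measurable_action].
Qed.

Lemma measurable_trajectory_cost t :
  measurable_fun [set: W] (fun w => c (state t w, action t w)).
Proof. exact: measurableT_comp mc (measurable_state_action t). Qed.

Let scaled_ge0 (a : R) t (w : W) : (0 <= a)%R ->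
  0 <= (a ^+ t)%:E * c (state t w, action t w).
Proof. by move=> a0; rewrite mule_ge0// lee_fin exprn_ge0. Qed.

Let measurable_scaled (a : R) t :
  measurable_fun [set: W] (fun w => (a ^+ t)%:E * c (state t w, action t w)).
Proof. by apply: measurable_funeM; exact: measurable_trajectory_cost. Qed.

Lemma v_horizonE N (a : R) pi x : (0 <= a)%R ->
  v_horizon c q N a pi x = \sum_(0 <= t < N) (a ^+ t)%:E * stage_cost pi x t.
Proof.
move=> a0; rewrite /v_horizon ge0_integral_sum//; last first.
  by move=> t w _; exact: scaled_ge0.
apply: eq_bigr => t _; rewrite ge0_integralZl//; last by rewrite lee_fin exprn_ge0.
exact: measurable_trajectory_cost.
Qed.

Lemma v_discountedE (a : R) pi x : (0 <= a)%R ->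
  v_discounted c q a pi x = \sum_(0 <= t <oo) (a ^+ t)%:E * stage_cost pi x t.
Proof.
move=> a0; rewrite /v_discounted integral_nneseries//; last first.
  by move=> t w _; exact: scaled_ge0.
apply: eq_eseriesr => t _; rewrite ge0_integralZl//; last by rewrite lee_fin exprn_ge0.
exact: measurable_trajectory_cost.
Qed.

Lemma measurable_kernel_integral (V : X -> \bar R) : measurable_fun setT V ->
  (forall y, 0 <= V y) ->
  measurable_fun setT (fun p : X * A => \int[q p]_y V y).
Proof.
move=> mV V0; apply: measurable_fun_integral_kernel => // U mU.
exact: measurable_kernel.
Qed.

Definition bellman (a : R) (V : X -> \bar R) (p : X * A) : \bar R :=
  c p + a%:E * \int[q p]_y V y.

Lemma bellman_ge0 (a : R) V p : (0 <= a)%R -> (forall y, 0 <= V y) ->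
  0 <= bellman a V p.
Proof. by move=> a0 V0; rewrite adde_ge0// mule_ge0 ?lee_fin// integral_ge0. Qed.

Lemma measurable_bellman (a : R) V : measurable_fun setT V ->
  (forall y, 0 <= V y) -> measurable_fun setT (bellman a V).
Proof.
move=> mV V0; apply: emeasurable_funD => //.
by apply: measurable_funeM; exact: measurable_kernel_integral.
Qed.

Lemma expectation_bellman (a : R) V pi x t : (0 <= a)%R ->
  measurable_fun setT V -> (forall y, 0 <= V y) ->
  \int[policy_measure q pi x]_w bellman a V (state t w, action t w) =
  stage_cost pi x t + a%:E * \int[policy_measure q pi x]_w V (state t.+1 w).
Proof.
move=> a0 mV V0; rewrite /bellman expectation_next//.
have mI : measurable_fun [set: W] (fun w => \int[q (state t w, action t w)]_y V y).
  exact: measurableT_comp (measurable_kernel_integral mV V0)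
    (measurable_state_action t).
have mcw : measurable_fun [set: W] (fun w => c (state t w, action t w)).
  exact: measurable_trajectory_cost.
have maI : measurable_fun [set: W]
    (fun w => a%:E * \int[q (state t w, action t w)]_y V y).
  exact: measurable_funeM.
have aI0 (w : W) : setT w -> 0 <= a%:E * \int[q (state t w, action t w)]_y V y.
  by move=> _; rewrite mule_ge0 ?lee_fin// integral_ge0.
rewrite ge0_integralD//.
by rewrite ge0_integralZl// => w _; exact: integral_ge0.
Qed.

Let sum_expS (a : R) (g : nat -> \bar R) k N : (0 <= a)%R -> (forall t, 0 <= g t) ->
  \sum_(0 <= t < N.+1) (a ^+ t)%:E * g (k + t)%N =
  g k + a%:E * \sum_(0 <= t < N) (a ^+ t)%:E * g (k.+1 + t)%N.
Proof.
move=> a0 g0; rewrite big_nat_recl//= expr0 mul1e addn0; congr (_ + _).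
rewrite ge0_sume_distrr; last first.
  by move=> t _; rewrite mule_ge0// lee_fin exprn_ge0.
by apply: eq_bigr => t _; rewrite exprS EFinM muleA addSnnS.
Qed.

(** Only the transition law of the state given the last state and action
    enters, so that the bound holds for history-dependent and randomized
    policies alike. *)
Lemma value_iteration_le_v_horizon (a : R) (V : nat -> X -> \bar R) pi x N :
  (0 <= a)%R -> (forall n, measurable_fun setT (V n)) -> (forall n y, 0 <= V n y) ->
  (forall y, V 0%N y = 0) -> (forall n y b, V n.+1 y <= bellman a (V n) (y, b)) ->
  V N x <= v_horizon c q N a pi x.
Proof.
move=> a0 mV V0 V00 VS; rewrite v_horizonE//.
pose E n k := \int[policy_measure q pi x]_w V n (state k w).
have step n k : E n.+1 k <= stage_cost pi x k + a%:E * E n k.+1.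
  rewrite -expectation_bellman//; apply: ge0_le_integral => //.
  - exact: measurableT_comp (mV _) (measurable_state k).
  - exact: measurableT_comp (measurable_bellman a (mV _) (V0 n))
      (measurable_state_action k).
have main n k : E n k <= \sum_(0 <= t < n) (a ^+ t)%:E * stage_cost pi x (k + t)%N.
  elim: n k => [|n IH] k.
    by rewrite big_geq// /E integral0_eq// => w _; exact: V00.
  rewrite sum_expS//; last by move=> t; exact: stage_cost_ge0.
  by apply: le_trans (step n k) _; rewrite leeD2l// lee_wpmul2l.
apply: le_trans (main N 0%N).
by rewrite /E (expectation_initial _ _ _ (mV N) (V0 N)).
Qed.

(** With w = 0 and a < 1 this bounds the discounted cost of a stationary
    policy, with a = 1 its average cost. *)
Lemma v_horizon_stationary_le (a w : R) (V : X -> \bar R) phi x N :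
  (0 <= a)%R -> (0 <= w)%R -> measurable_fun setT V -> (forall y, 0 <= V y) ->
  (forall y, bellman a V (y, phi y) <= w%:E + V y) ->
  v_horizon c q N a (stationary_policy R phi) x <=
    (\sum_(0 <= t < N) a ^+ t * w)%:E + V x.
Proof.
move=> a0 w0 mV V0 VS; rewrite v_horizonE//.
set pi := stationary_policy R phi.
pose E k := \int[policy_measure q pi x]_u V (state k u).
have mE k : measurable_fun [set: W] (fun u => V (state k u)).
  exact: measurableT_comp mV (measurable_state k).
have step k : stage_cost pi x k + a%:E * E k.+1 <= w%:E + E k.
  rewrite -expectation_bellman// expectation_stationary; first last.
  - by move=> p; exact: bellman_ge0.
  - exact: measurable_bellman.
  have -> : w%:E + E k = \int[policy_measure q pi x]_u (w%:E + V (state k u)).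
    have w0' (u : W) : setT u -> 0 <= w%:E by rewrite lee_fin.
    rewrite (ge0_integralD _ _ w0')//.
    by rewrite integral_cst// [X in w%:E * X]probability_setT mule1.
  apply: ge0_le_integral => //.
  - by move=> u _; exact: bellman_ge0.
  - apply: measurableT_comp (measurable_bellman a mV V0) _.
    apply: measurable_fun_pair; first exact: measurable_state.
    exact: measurableT_comp (measurable_state k).
  - by apply: emeasurable_funD.
have main n k : \sum_(0 <= t < n) (a ^+ t)%:E * stage_cost pi x (k + t)%N <=
    (\sum_(0 <= t < n) a ^+ t * w)%:E + E k.
  elim: n k => [|n IH] k.
    by rewrite !big_geq// add0e integral_ge0.
  rewrite sum_expS//; last by move=> t; exact: stage_cost_ge0.
  have -> : (\sum_(0 <= t < n.+1) a ^+ t * w)%R =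
      (a * (\sum_(0 <= t < n) a ^+ t * w) + w)%R.
    rewrite big_nat_recl//= expr0 mul1r addrC big_distrr/=; congr (_ + _)%R.
    by apply: eq_bigr => t _; rewrite exprS mulrA.
  apply: (@le_trans _ _ (stage_cost pi x k +
      a%:E * ((\sum_(0 <= t < n) a ^+ t * w)%:E + E k.+1))).
    by rewrite leeD2l// lee_wpmul2l.
  rewrite ge0_muleDr ?lee_fin ?sumr_ge0//; last 2 first.
  - by move=> t _; rewrite mulr_ge0// exprn_ge0.
  - exact: integral_ge0.
  by rewrite addeCA EFinD -EFinM -[leRHS]addeA; apply: leeD2l.
apply: le_trans (main N 0%N) _.
by rewrite /E (expectation_initial _ _ _ mV V0).
Qed.

Lemma v_horizon_le_discounted (a : R) pi x N : (0 <= a)%R ->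
  v_horizon c q N a pi x <= v_discounted c q a pi x.
Proof.
move=> a0; rewrite v_horizonE// v_discountedE//; apply: nneseries_lim_ge => t _ _.
by rewrite mule_ge0 ?stage_cost_ge0// lee_fin exprn_ge0.
Qed.

Lemma v_discounted_ub (a : R) pi x (l : \bar R) : (0 <= a)%R ->
  (forall N, v_horizon c q N a pi x <= l) -> v_discounted c q a pi x <= l.
Proof.
move=> a0 vl; rewrite v_discountedE//; apply: lime_le.
  apply: is_cvg_nneseries => t _ _.
  by rewrite mule_ge0 ?stage_cost_ge0// lee_fin exprn_ge0.
by apply: nearW => N; rewrite -v_horizonE.
Qed.

End costs.

(** * The discounted-cost optimality equation *)

Section discounted_optimality.
Context (R : realType) (PX PA : polishType R).
Context (X : borelSubset PX) (A : borelSubset PA).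
Variables (c : X * A -> \bar R) (q : R.-pker (X * A) ~> X).
Hypotheses (mc : measurable_fun setT c) (c0 : forall p, 0 <= c p).
Hypotheses (Kc : K_inf_compact c) (wq : weakly_continuous q).

Lemma K_inf_compact_bellman (a : R) (V : X -> \bar R) : (0 <= a)%R ->
  (forall y, 0 <= V y) -> lower_semicontinuous V ->
  K_inf_compact (bellman c q a V).
Proof.
move=> a0 V0 lV; apply: K_inf_compactD => //.
  by move=> p; rewrite mule_ge0 ?lee_fin// integral_ge0.
by apply: lower_semicontinuousZ => //; exact: integral_lower_semicontinuous.
Qed.

Lemma le_bellman (a b : R) (V W : X -> \bar R) p : (0 <= a <= b)%R ->
  measurable_fun setT V -> measurable_fun setT W ->
  (forall y, 0 <= V y) -> (forall y, V y <= W y) ->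
  bellman c q a V p <= bellman c q b W p.
Proof.
move=> /andP[a0 ab] mV mW V0 VW; rewrite leeD2l//.
have VWi : \int[q p]_y V y <= \int[q p]_y W y.
  by apply: ge0_le_integral => // y _; exact: VW.
apply: (@le_trans _ _ (a%:E * \int[q p]_y W y)).
  by rewrite lee_wpmul2l// lee_fin.
by rewrite lee_wpmul2r ?lee_fin// (le_trans _ VWi)// integral_ge0.
Qed.

Variable a : R.
Hypothesis a0 : (0 <= a)%R.

Fixpoint value_iteration n : X -> \bar R :=
  if n is m.+1 then section_inf (bellman c q a (value_iteration m)) setT
  else cst 0.

Lemma value_iteration_ge0 n y : 0 <= value_iteration n y.
Proof.
elim: n y => [|n IH] y //=; apply: le_ereal_inf_tmp => _ [b _ <-].
exact: bellman_ge0.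
Qed.

Lemma lower_semicontinuous_cst0 : lower_semicontinuous (cst 0 : X -> \bar R).
Proof. by move=> x b b0; exists setT => //; exact: filterT. Qed.

Lemma value_iteration_lower_semicontinuous n :
  lower_semicontinuous (value_iteration n).
Proof.
elim: n => [|n IH] /=; first exact: lower_semicontinuous_cst0.
have IH0 := value_iteration_ge0 n.
apply: section_inf_lower_semicontinuous; last exact: closedT.
- exact: K_inf_compact_bellman.
- by move=> p; exact: bellman_ge0.
Qed.

Lemma measurable_value_iteration n : measurable_fun setT (value_iteration n).
Proof.
apply: borel_lower_semicontinuous_measurable.
exact: value_iteration_lower_semicontinuous.
Qed.

Lemma value_iteration_le_bellman n y b :
  value_iteration n.+1 y <= bellman c q a (value_iteration n) (y, b).
Proof. by apply: ereal_inf_lbound; exists b. Qed.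

Lemma value_iterationS_ge n y : value_iteration n y <= value_iteration n.+1 y.
Proof.
elim: n y => [|n IH] y; first exact: value_iteration_ge0.
apply: le_ereal_inf_tmp => _ [b _ <-].
apply: le_trans (value_iteration_le_bellman n y b) _.
apply: le_bellman => //; first by rewrite a0 lexx.
- exact: measurable_value_iteration.
- exact: (measurable_value_iteration n.+1).
- by move=> z; exact: value_iteration_ge0.
Qed.

Lemma value_iteration_nd y : nondecreasing_seq (value_iteration ^~ y).
Proof. by apply/nondecreasing_seqP => n; exact: value_iterationS_ge. Qed.

Definition value_limit y : \bar R := ereal_sup (range (value_iteration ^~ y)).

Lemma value_iteration_le_limit n y : value_iteration n y <= value_limit y.
Proof. by apply: ereal_sup_ubound; exists n. Qed.

Lemma value_limit_cvg y : value_iteration n y @[n --> \oo] --> value_limit y.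
Proof. exact: ereal_nondecreasing_cvgn (@value_iteration_nd y). Qed.

Lemma value_limit_ge0 y : 0 <= value_limit y.
Proof. exact: le_trans (value_iteration_le_limit 0 y). Qed.

Lemma value_limit_lower_semicontinuous : lower_semicontinuous value_limit.
Proof.
apply: (lower_semicontinuous_sup (f := value_iteration)).
- exact: value_iteration_lower_semicontinuous.
- exact: value_iteration_le_limit.
- by move=> x l /ereal_sup_gt[_ [n _ <-] ln]; exists n.
Qed.

Lemma measurable_value_limit : measurable_fun setT value_limit.
Proof.
exact: borel_lower_semicontinuous_measurable value_limit_lower_semicontinuous.
Qed.

Lemma bellman_limit_le p (l : \bar R) :
  (forall n, bellman c q a (value_iteration n) p <= l) ->
  bellman c q a value_limit p <= l.
Proof.
move=> bl.
have intc : \int[q p]_y value_iteration n y @[n --> \oo] --> \int[q p]_y value_limit y.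
  have -> : \int[q p]_y value_limit y = \int[q p]_y limn (value_iteration ^~ y).
    apply: eq_integral => y _; apply/esym/cvg_lim => //; exact: value_limit_cvg.
  apply: cvg_monotone_convergence => //.
  - by move=> n; exact: measurable_value_iteration.
  - by move=> n y _; exact: value_iteration_ge0.
  - by move=> y _; exact: value_iteration_nd.
have : bellman c q a (value_iteration n) p @[n --> \oo] --> bellman c q a value_limit p.
  apply: cvgeD.
  - apply: ge0_adde_def; rewrite inE//.
    by rewrite mule_ge0 ?lee_fin// integral_ge0// => y _; exact: value_limit_ge0.
  - exact: cvg_cst.
  - by apply: cvgeZl.
move=> bc; rewrite -(cvg_lim _ bc)//; apply: lime_le; first exact: cvgP bc.
exact: nearW.
Qed.

Lemma value_limit_le_bellman y b : value_limit y <= bellman c q a value_limit (y, b).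
Proof.
apply: ge_ereal_sup => _ [[|n] _ <-].
  by apply: bellman_ge0 => // z; exact: value_limit_ge0.
apply: le_trans (value_iteration_le_bellman n y b) _.
apply: le_bellman; first by rewrite a0 lexx.
- exact: measurable_value_iteration.
- exact: measurable_value_limit.
- by move=> z; exact: value_iteration_ge0.
- by move=> z; exact: value_iteration_le_limit.
Qed.

(** An action attaining the n-th minimum costs at most the limit, for each n;
    [K_inf_compact_limit] provides one action for all n. *)
Lemma value_limit_ge_bellman y : value_limit y < +oo ->
  exists b, bellman c q a value_limit (y, b) <= value_limit y.
Proof.
move=> yoo; have [l El] : exists l : R, value_limit y = l%:E.
  by move: yoo (value_limit_ge0 y); case: (value_limit y) => // l; exists l.
have KB n : K_inf_compact (bellman c q a (value_iteration n)).
  apply: K_inf_compact_bellman => //; first exact: value_iteration_ge0.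
  exact: value_iteration_lower_semicontinuous.
have BS n p : bellman c q a (value_iteration n) p <=
    bellman c q a (value_iteration n.+1) p.
  apply: le_bellman; first by rewrite a0 lexx.
  - exact: measurable_value_iteration.
  - exact: measurable_value_iteration.
  - exact: value_iteration_ge0.
  - exact: value_iterationS_ge.
have [|b _ bP] := @K_inf_compact_limit _ _ _ _ _
  (fun n => bellman c q a (value_iteration n)) setT y l KB closedT BS.
  move=> k e e0; have := value_iteration_le_limit k.+1 y; rewrite El => /= kl.
  have [||b _ Eb] := @section_inf_attained _ _ _ _ _
    (bellman c q a (value_iteration k)) setT y (KB k) _ closedT.
  - by move=> p; apply: bellman_ge0 => // z; exact: value_iteration_ge0.
  - exact: le_lt_trans kl (ltry _).
  by exists b => //; rewrite Eb (le_trans kl)// lee_fin lerDl ltW.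
by exists b; rewrite El; exact: bellman_limit_le.
Qed.

Lemma value_limit_le_v_opt y : value_limit y <= v_opt c q a y.
Proof.
apply: ge_ereal_sup => _ [n _ <-]; apply: le_ereal_inf_tmp => _ [pi _ <-].
apply: (@le_trans _ _ (v_horizon c q n a pi y)); last first.
  exact: v_horizon_le_discounted.
apply: value_iteration_le_v_horizon => //.
- exact: measurable_value_iteration.
- exact: value_iteration_ge0.
- exact: value_iteration_le_bellman.
Qed.

Hypothesis v_opt_lty : forall y, v_opt c q a y < +oo.

(** The limit of value iteration is a lower bound for all policies, and a
    stationary policy of minimizers attains it. *)
Lemma value_limit_v_opt : value_limit = v_opt c q a.
Proof.
apply/funext => y; apply/eqP; rewrite eq_le value_limit_le_v_opt/=.
have loo z : value_limit z < +oo by exact: le_lt_trans (value_limit_le_v_opt z) _.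
have KB : K_inf_compact (bellman c q a value_limit).
  apply: K_inf_compact_bellman => //; first exact: value_limit_ge0.
  exact: value_limit_lower_semicontinuous.
have B0 p : 0 <= bellman c q a value_limit p.
  by apply: bellman_ge0 => // z; exact: value_limit_ge0.
have Boo z : exists b, bellman c q a value_limit (z, b) < +oo.
  by have [b bP] := value_limit_ge_bellman (loo z); exists b; exact: le_lt_trans bP _.
have [phi phiP] := measurable_minimizer KB B0 Boo.
have phiV z : bellman c q a value_limit (z, phi z) <= 0%:E + value_limit z.
  have [b bP] := value_limit_ge_bellman (loo z).
  by rewrite add0e (le_trans (phiP z b)).
apply: (@le_trans _ _ (v_discounted c q a (stationary_policy R phi) y)).
  by apply: ereal_inf_lbound; eexists.
apply: v_discounted_ub => // N.
apply: le_trans (v_horizon_stationary_le mc c0 y N a0 (lexx 0%R)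
  measurable_value_limit value_limit_ge0 phiV) _.
by rewrite big1 ?add0e// => t _; rewrite mulr0.
Qed.

Theorem discounted_optimality_equation :
  [/\ lower_semicontinuous (v_opt c q a),
      forall y b, v_opt c q a y <= bellman c q a (v_opt c q a) (y, b) &
      forall y, exists b, bellman c q a (v_opt c q a) (y, b) <= v_opt c q a y].
Proof.
rewrite -value_limit_v_opt; split.
- exact: value_limit_lower_semicontinuous.
- exact: value_limit_le_bellman.
- move=> y; apply: value_limit_ge_bellman.
  exact: le_lt_trans (value_limit_le_v_opt y) _.
Qed.

End discounted_optimality.

(** * A Tauberian inequality *)

(** Abel summation: decreasing weights preserve the nonnegativity of partial
    sums. *)
Lemma abel_bound (R : realType) (a l M : R) (h : nat -> R) (T : nat) :
  (0 <= a <= 1)%R ->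
  (forall n, \sum_(0 <= t < n) h t <= l * n%:R + M)%R ->
  (\sum_(0 <= t < T) a ^+ t * h t <= l * (\sum_(0 <= t < T) a ^+ t) + M)%R.
Proof.
move=> /andP[a0 a1] hM.
pose H n := (l * n%:R + M - \sum_(0 <= t < n) h t)%R.
have H0 n : (0 <= H n)%R by rewrite subr_ge0.
suff : (a ^+ T * H T <= l * (\sum_(0 <= t < T) a ^+ t) + M -
    \sum_(0 <= t < T) a ^+ t * h t)%R.
  move=> /(le_trans _) => /(_ 0%R); rewrite subr_ge0; apply.
  by rewrite mulr_ge0// exprn_ge0.
elim: T => [|n IH]; first by rewrite /H !big_geq// !mulr0 expr0 mul1r !add0r.
have HS : H n.+1 = (H n + (l - h n))%R.
  by rewrite /H big_nat_recr//= -natr1; ring.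
rewrite !big_nat_recr//=.
have : (a ^+ n.+1 * H n.+1 <= a ^+ n * H n.+1)%R.
  by rewrite ler_wpM2r// exprS ler_piMl// exprn_ge0.
rewrite [X in (_ <= a ^+ n * X)%R -> _]HS => le1; apply: (le_trans le1).
move: IH; set S1 := (\sum_(0 <= t < n) a ^+ t)%R.
set S2 := (\sum_(0 <= t < n) a ^+ t * h t)%R; set p := (a ^+ n)%R => IH.
have -> : (p * (H n + (l - h n)) = p * H n + p * (l - h n))%R by rewrite mulrDr.
have -> : (l * (S1 + p) + M - (S2 + p * h n) =
    (l * S1 + M - S2) + p * (l - h n))%R by ring.
by rewrite lerD2r.
Qed.

Lemma geometric_sum_le (R : realType) (a : R) T : (0 <= a < 1)%R ->
  ((1 - a) * (\sum_(0 <= t < T) a ^+ t) <= 1)%R.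
Proof.
move=> /andP[a0 a1]; rewrite big_mkord.
have : (1 - a ^+ T = (1 - a) * \sum_(i < T) a ^+ i)%R.
  by rewrite -[in RHS]opprB mulNr -subrX1 opprB.
by move=> <-; rewrite gerBl exprn_ge0.
Qed.

Section tauberian.
Context (R : realType) d d' (X : measurableType d) (A : measurableType d').
Variables (c : X * A -> \bar R) (q : R.-pker (X * A) ~> X).
Hypotheses (mc : measurable_fun setT c) (c0 : forall p, 0 <= c p).

Lemma v_horizon_ge0 N (a : R) pi x : (0 <= a)%R -> 0 <= v_horizon c q N a pi x.
Proof.
move=> a0; apply: integral_ge0 => w _; apply: sume_ge0 => t _.
by rewrite mule_ge0// lee_fin exprn_ge0.
Qed.

Lemma v_discounted_ge0 (a : R) pi x : (0 <= a)%R -> 0 <= v_discounted c q a pi x.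
Proof.
move=> a0; apply: le_trans (v_horizon_le_discounted q mc c0 pi x 0 a0).
exact: v_horizon_ge0.
Qed.

Lemma v_horizon_nd (a : R) pi x m n : (0 <= a)%R -> (m <= n)%N ->
  v_horizon c q m a pi x <= v_horizon c q n a pi x.
Proof.
move=> a0 mn; rewrite !v_horizonE//; apply: lee_sum_nneg_natr => // t _ _.
by rewrite mule_ge0 ?stage_cost_ge0// lee_fin exprn_ge0.
Qed.

Lemma v_horizon1E N pi x :
  v_horizon c q N 1%R pi x = \sum_(0 <= t < N) stage_cost c q pi x t.
Proof.
by rewrite v_horizonE//; apply: eq_bigr => t _; rewrite expr1n mul1e.
Qed.

(** An average cost below l bounds the n-stage costs by l n + M, which Abel
    summation turns into a bound on the discounted cost. *)
Lemma discounted_le_average pi x (l : R) : w_average c q pi x < l%:E ->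
  exists2 M : R, (0 <= M)%R & forall a, (0 <= a < 1)%R ->
    (1 - a)%:E * v_discounted c q a pi x <= (l + (1 - a) * M)%:E.
Proof.
rewrite /w_average limn_esup_lim => wl.
have [N vN] : exists N, forall n, (N <= n)%N -> v_horizon c q n.+1 1%R pi x <=
    (l * n.+1%:R)%:E.
  set s := esups _ in wl.
  have sc : cvgn s by exact: is_cvg_esups.
  have sO : nbhs (limn s) [set r | r < l%:E].
    by apply: open_nbhs_nbhs; split => //; exact: open_ereal_lt_ereal.
  have [N _ sN] := sc _ sO.
  exists N => n Nn.
  have : (n.+1%:R^-1)%:E * v_horizon c q n.+1 1%R pi x < l%:E.
    apply: le_lt_trans (sN N (leqnn N)); apply: ereal_sup_ubound.
    by exists n.
  by move=> /ltW; rewrite lee_pdivrMl// mulrC EFinM.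
(* the slope l is only available from N on; the first N+1 stages are put into
   the constant M *)
have fN : v_horizon c q N.+1 1%R pi x \is a fin_num.
  by rewrite ge0_fin_numE ?v_horizon_ge0// (le_lt_trans (vN N (leqnn N)))// ltry.
pose M := fine (v_horizon c q N.+1 1%R pi x).
have M0 : (0 <= M)%R by rewrite fine_ge0// v_horizon_ge0.
have l0 : (0 <= l)%R.
  have := le_trans (v_horizon_ge0 N.+1 pi x ler01) (vN N (leqnn N)).
  by rewrite lee_fin pmulr_lge0.
have vM n : v_horizon c q n 1%R pi x <= (l * n%:R + M)%:E.
  have [nN|Nn] := leqP n N.+1.
    apply: le_trans (v_horizon_nd pi x ler01 nN) _.
    by rewrite -(fineK fN) lee_fin lerDr mulr_ge0.
  case: n Nn => // n Nn; apply: le_trans (vN n _) _; first exact: ltnW.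
  by rewrite lee_fin lerDl.
pose h t := fine (stage_cost c q pi x t).
have hE t : stage_cost c q pi x t = (h t)%:E.
  rewrite fineK// ge0_fin_numE ?stage_cost_ge0//.
  apply: le_lt_trans (ltry (l * t.+1%:R + M)); apply: le_trans (vM t.+1).
  rewrite v_horizon1E big_nat_recr//= leeDr// sume_ge0// => i _.
  exact: stage_cost_ge0.
have hM n : (\sum_(0 <= t < n) h t <= l * n%:R + M)%R.
  rewrite -lee_fin; apply: le_trans (vM n); rewrite v_horizon1E -sumEFin.
  by apply: lee_sum => t _; rewrite hE.
exists M => // a /andP[a0 a1].
have a1' : (0 < 1 - a)%R by rewrite subr_gt0.
rewrite -lee_pdivlMl//; apply: v_discounted_ub => // T.
rewrite lee_pdivlMl// v_horizonE//.
have -> : \sum_(0 <= t < T) (a ^+ t)%:E * stage_cost c q pi x t =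
    (\sum_(0 <= t < T) a ^+ t * h t)%:E.
  by rewrite -sumEFin; apply: eq_bigr => t _; rewrite hE EFinM.
rewrite -EFinM lee_fin.
have a01 : (0 <= a <= 1)%R by rewrite a0 ltW.
apply: (@le_trans _ _ ((1 - a) * (l * (\sum_(0 <= t < T) a ^+ t) + M))%R).
  by rewrite ler_wpM2l ?(ltW a1')//; exact: abel_bound.
rewrite mulrDr lerD2r mulrCA ler_piMr//.
by apply: geometric_sum_le; rewrite a0.
Qed.

End tauberian.

(** * The vanishing discount limit for nonnegative costs *)

Lemma limn_esup_lt (R : realType) (s : (\bar R)^nat) (l : \bar R) :
  limn_esup s < l -> exists N, forall n, (N <= n)%N -> s n < l.
Proof.
rewrite limn_esup_lim => sl.
have sO : nbhs (limn (esups s)) [set r | r < l].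
  by apply: open_nbhs_nbhs; split => //; exact: open_ereal_lt_ereal.
have sc : cvgn (esups s) by exact: is_cvg_esups.
have [N _ NP] := sc _ sO; exists N => n Nn.
by apply: le_lt_trans (NP N (leqnn N)); apply: ereal_sup_ubound; exists n.
Qed.

(** Split f n at a level K beyond which its integral is small in the limit; the
    truncations at K are dominated. *)
Lemma asymptotically_uniformly_integrable_limit (R : realType) d
    (T : measurableType d) (mu : {measure set T -> \bar R})
    (f : nat -> T -> \bar R) (g : T -> \bar R) :
  mu setT < +oo -> (forall n, measurable_fun setT (f n)) ->
  (forall n y, 0 <= f n y) -> (forall n y, f n y \is a fin_num) ->
  (forall y, g y \is a fin_num) -> (forall y, f n y @[n --> \oo] --> g y) ->
  asymptotically_uniformly_integrable mu f ->
  forall e : R, (0 < e)%R -> exists N, forall n, (N <= n)%N ->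
    \int[mu]_y f n y <= \int[mu]_y g y + e%:E.
Proof.
move=> muT mf f0 ffin gfin fg ui e e0.
have g0 y : 0 <= g y.
  by rewrite -(cvg_lim _ (fg y))//; apply: lime_ge; [exact: cvgP (fg y)|exact: nearW].
have mg : measurable_fun setT g.
  by apply: (emeasurable_fun_cvg f) => // y _; exact: fg.
have e20 : (0 < e / 2)%R by rewrite divr_gt0.
have [K0 [_ KP]] : \forall K \near +oo%R, limn_esup (fun n => \int[mu]_z
    (f n z * (\1_[set y | (K%:E <= f n y)%E] z)%:E)) < (e / 2)%:E.
  apply: (ui [set s | s < (e / 2)%:E]); apply: open_nbhs_nbhs.
  by split; [exact: open_ereal_lt_ereal|rewrite /= lte_fin].
pose K := Num.max (K0 + 1)%R 1%R.
have K00 : (K0 < K)%R by rewrite lt_max ltrDl ltr01.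
have K1 : (0 < K)%R by rewrite lt_max ltr01 orbT.
have [N1 N1P] := limn_esup_lt (KP K K00).
(* truncation at K, through R, where the minimum is known to be continuous *)
pose h (k : \bar R) := (Num.min (fine k) K)%:E.
have mh (k : T -> \bar R) : measurable_fun setT k -> measurable_fun setT (h \o k).
  move=> mk; apply/measurable_EFinP; apply: measurable_minr => //.
  by apply: measurableT_comp mk; exact: fine_measurable.
have h0 k : 0 <= k -> 0 <= h k.
  by move=> k0; rewrite lee_fin le_min fine_ge0// ltW.
have hK k : h k <= K%:E by rewrite lee_fin ge_min lexx orbT.
have hk k : k \is a fin_num -> h k <= k.
  by move=> kf; rewrite -[leRHS]fineK// lee_fin ge_min lexx.
have hcvg : \int[mu]_y h (f n y) @[n --> \oo] --> \int[mu]_y h (g y).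
  apply: (@dominated_cvg _ _ _ mu setT measurableT (fun n y => h (f n y)) _
    (cst K%:E)) => //.
  - by move=> n; exact: (mh (f n)).
  - move=> y _; apply: cvg_EFin; first exact: nearW.
    have gy : f n y @[n --> \oo] --> (fine (g y))%:E by rewrite fineK//; exact: fg.
    have cm : {for fine (g y), continuous ((id : R^o -> R^o) \min cst K)}.
      by apply: continuous_min; [exact: cvg_id|exact: cvg_cst].
    exact: (cvg_comp _ _ (fine_cvg gy) cm).
  - apply/integrableP; split; first exact: measurable_cst.
    by rewrite /= integral_cst// lte_mul_pinfty.
  - by move=> n y _; rewrite gee0_abs ?h0.
have hfin : \int[mu]_y h (g y) \is a fin_num.
  rewrite ge0_fin_numE; last by apply: integral_ge0 => y _; exact: h0.
  apply: (@le_lt_trans _ _ (\int[mu]__ K%:E)); last first.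
    by rewrite integral_cst// lte_mul_pinfty ?lee_fin ?(ltW K1).
  apply: ge0_le_integral => //.
  - by move=> y _; exact: h0.
  - exact: (mh g).
have hO : nbhs (\int[mu]_y h (g y)) [set s | s < \int[mu]_y h (g y) + (e / 2)%:E].
  apply: open_nbhs_nbhs; split; first exact: open_ereal_lt_ereal.
  by rewrite /= lteDl.
have [N2 _ N2P] := hcvg _ hO.
exists (maxn N1 N2) => n; rewrite geq_max => /andP[n1 n2].
apply: (@le_trans _ _ (\int[mu]_y h (f n y) + \int[mu]_z
    (f n z * (\1_[set y | (K%:E <= f n y)%E] z)%:E))).
  have mS : measurable [set y | K%:E <= f n y].
    by rewrite -[X in measurable X]setTI; exact: emeasurable_fun_c_infty.
  have mI : measurable_fun setT
      (fun z => f n z * (\1_[set y | (K%:E <= f n y)%E] z)%:E).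
    apply: emeasurable_funM => //; apply/measurable_EFinP.
    exact: measurable_indic.
  have I0 z : 0 <= f n z * (\1_[set y | (K%:E <= f n y)%E] z)%:E.
    by rewrite mule_ge0// lee_fin.
  rewrite -ge0_integralD//; last 2 first.
  - by move=> y _; exact: h0.
  - exact: (mh (f n)).
  apply: ge0_le_integral => //.
  - by apply: emeasurable_funD => //; exact: (mh (f n)).
  - move=> y _; have [Kf|fK] := leP K%:E (f n y).
      rewrite indicE mem_set// mule1 leeDr//; exact: h0.
    rewrite indicE memNset//=; last by rewrite leNgt fK.
    rewrite mule0 adde0 /h min_l ?fineK//.
    by rewrite -lee_fin fineK// ltW.
apply: (@le_trans _ _ (\int[mu]_y h (g y) + (e / 2)%:E + (e / 2)%:E)).
  by apply: leeD; [exact: ltW (N2P n n2)|exact: ltW (N1P n n1)].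
rewrite -addeA -EFinD -splitr leeD2r//; apply: ge0_le_integral => //.
- by move=> y _; exact: h0.
- exact: (mh g).
- by move=> y _; exact: hk.
Qed.

Lemma fin_num_lty (R : realType) (x : \bar R) : x \is a fin_num -> x < +oo.
Proof. by rewrite ltey_eq => ->. Qed.

Section vanishing_discount.
Context (R : realType) (PX PA : polishType R).
Context (X : borelSubset PX) (A : borelSubset PA).
Variables (c : X * A -> \bar R) (q : R.-pker (X * A) ~> X) (alpha : nat -> R).
Hypotheses (mc : measurable_fun setT c) (c0 : forall p, 0 <= c p).
Hypotheses (Kc : K_inf_compact c) (wq : weakly_continuous q).
Hypothesis alpha_range : forall n, (0 <= alpha n < 1)%R.
Hypothesis alpha_nd : nondecreasing_seq alpha.
Hypothesis alpha_cvg : alpha n @[n --> \oo] --> (1%R : R).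
Hypothesis w_star_lty : w_star c q < +oo.
Hypothesis u_fin : forall n x, u_disc c q (alpha n) x \is a fin_num.
Hypothesis u_lse :
  lower_semi_equicontinuous (fun n (x : X) => fine (u_disc c q (alpha n) x)).
Hypothesis u_cvg : forall x, cvg (u_disc c q (alpha n) x @[n --> \oo]).
Hypothesis u_lim_lty : forall x, u_liminf c q alpha x < +oo.

Local Notation v n := (v_opt c q (alpha n)).
Local Notation u n := (u_disc c q (alpha n)).
Let m n : R := fine (m_disc c q (alpha n)).
Let r n : R := ((1 - alpha n) * m n)%R.
Local Notation ulim := (u_liminf c q alpha).

Let alpha_ge0 n : (0 <= alpha n)%R.
Proof. by have /andP[] := alpha_range n. Qed.

Let v_fin n x : v n x \is a fin_num.
Proof. by have := u_fin n x; rewrite /u_disc fin_numB => /andP[]. Qed.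

Let mE n : m_disc c q (alpha n) = (m n)%:E.
Proof.
have := u_fin n point; rewrite /u_disc fin_numB => /andP[_ mf].
by rewrite fineK.
Qed.

Let v_ge0 n x : 0 <= v n x.
Proof.
by apply: le_ereal_inf_tmp => _ [pi _ <-]; exact: v_discounted_ge0.
Qed.

Let m_ge0 n : (0 <= m n)%R.
Proof.
by rewrite -lee_fin -mE; apply: le_ereal_inf_tmp => _ [x _ <-]; exact: v_ge0.
Qed.

Let r_ge0 n : (0 <= r n)%R.
Proof.
by rewrite mulr_ge0// subr_ge0; have /andP[_ /ltW] := alpha_range n.
Qed.

Let vE n x : v n x = u n x + (m n)%:E.
Proof. by rewrite /u_disc mE subeK. Qed.

Let u_ge0 n x : 0 <= u n x.
Proof.
rewrite /u_disc sube_ge0; last by rewrite v_fin orbT.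
by apply: ereal_inf_lbound; exists x.
Qed.

Let doe n := discounted_optimality_equation mc c0 Kc wq (alpha_ge0 n)
  (fun y => fin_num_lty (v_fin n y)).

Let measurable_v n : measurable_fun setT (v n).
Proof. by apply: borel_lower_semicontinuous_measurable; have [] := doe n. Qed.

Let measurable_u n : measurable_fun setT (u n).
Proof.
by apply: emeasurable_funB => //; exact: measurable_cst.
Qed.

Let bellman_v n p : bellman c q (alpha n) (v n) p =
  bellman c q (alpha n) (u n) p + (alpha n * m n)%:E.
Proof.
rewrite /bellman -addeA EFinM -ge0_muleDr//; last 2 first.
- exact: integral_ge0.
- by rewrite lee_fin.
congr (_ + _ * _); under eq_integral do rewrite vE.
rewrite ge0_integralD//; last by move=> y _; rewrite lee_fin.
by rewrite integral_cst// prob_kernel mule1.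
Qed.

Let v_shift n x : v n x = (r n)%:E + u n x + (alpha n * m n)%:E.
Proof.
rewrite vE [RHS]addeAC -EFinD [RHS]addeC; congr (_ + _%:E).
by rewrite /r; ring.
Qed.

(** The discounted optimality equation rewritten for the relative value
    function u, in which (1 - alpha) m plays the role of the average cost. *)
Let u_le_bellman n x b : (r n)%:E + u n x <= bellman c q (alpha n) (u n) (x, b).
Proof.
have [_ /(_ x b) + _] := doe n; rewrite v_shift bellman_v.
by rewrite leeD2rE.
Qed.

Let u_ge_bellman n x :
  exists b, bellman c q (alpha n) (u n) (x, b) <= (r n)%:E + u n x.
Proof.
have [_ _ /(_ x)[b]] := doe n; rewrite v_shift bellman_v leeD2rE// => le.
by exists b.
Qed.

Let U N x : \bar R := einfs (fun n => u n x) N.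

Let U_le N n x : (N <= n)%N -> U N x <= u n x.
Proof. by move=> Nn; apply: ereal_inf_lbound; exists n. Qed.

Let U_ge0 N x : 0 <= U N x.
Proof. by apply: le_ereal_inf_tmp => _ [n _ <-]; exact: u_ge0. Qed.

Let U_nd x : nondecreasing_seq (U ^~ x).
Proof. exact: nondecreasing_einfs. Qed.

Let U_cvg x : U n x @[n --> \oo] --> ulim x.
Proof. by rewrite /u_liminf limn_einf_lim; exact: is_cvg_einfs. Qed.

Let U_le_ulim N x : U N x <= ulim x.
Proof.
rewrite /u_liminf limn_einf_lim; apply: lime_ge; first exact: is_cvg_einfs.
by exists N => // n /= Nn; exact: U_nd.
Qed.

Let u_cvg_ulim x : u n x @[n --> \oo] --> ulim x.
Proof. by rewrite /u_liminf is_cvg_limn_einfE//; exact: u_cvg. Qed.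

Let ulim_ge0 x : 0 <= ulim x.
Proof. exact: le_trans (U_ge0 0 x) (U_le_ulim 0 x). Qed.

(** The modulus in lower semi-equicontinuity serves all n at once, hence also
    the infimum. *)
Let U_lower_semicontinuous N : lower_semicontinuous (U N).
Proof.
move=> x l lU; have [b [lb bU]] : exists b : R, (l < b)%R /\ b%:E < U N x.
  have := le_lt_trans (U_le x (leqnn N)) (fin_num_lty (u_fin N x)).
  move: lU; case: (U N x) => [s| |]//; rewrite lte_fin => ls _.
  exists ((l + s) / 2)%R; rewrite lte_fin; split; lra.
have e0 : (0 < (b - l) / 2)%R by rewrite divr_gt0// subr_gt0.
have [delta d0 dP] := u_lse x e0.
exists (ball x delta); first exact: nbhsx_ballx.
move=> y /dP yP; apply: (@lt_le_trans _ _ ((l + b) / 2)%:E).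
  by rewrite lte_fin; lra.
apply: le_ereal_inf_tmp => _ [n /= Nn <-].
have := lt_le_trans bU (U_le x Nn); have := yP n.
rewrite -(fineK (u_fin n x)) -(fineK (u_fin n y)) lte_fin lee_fin /=; lra.
Qed.

Let measurable_U N : measurable_fun setT (U N).
Proof. exact: borel_lower_semicontinuous_measurable. Qed.

Lemma ulim_lower_semicontinuous : lower_semicontinuous ulim.
Proof.
apply: (lower_semicontinuous_sup (f := U)) => // x l lu.
have : nbhs (ulim x) [set s | l%:E < s].
  by apply: open_nbhs_nbhs; split => //; exact: open_ereal_gt_ereal.
by move=> /U_cvg[N _ /(_ N (leqnn N)) lN]; exists N.
Qed.

Let ulim_fin x : ulim x \is a fin_num.
Proof. by rewrite ge0_fin_numE. Qed.

Let u_le_ulim x (e : R) : (0 < e)%R ->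
  exists N, forall n, (N <= n)%N -> u n x <= ulim x + e%:E.
Proof.
move=> e0; have : nbhs (ulim x) [set s | s < ulim x + e%:E].
  apply: open_nbhs_nbhs; split; first exact: open_ereal_lt_ereal.
  by rewrite /= lteDl.
by move=> /u_cvg_ulim[N _ NP]; exists N => n /NP/ltW.
Qed.

Let measurable_ulim : measurable_fun setT ulim.
Proof.
exact: borel_lower_semicontinuous_measurable ulim_lower_semicontinuous.
Qed.

Let K_inf_compact_bellman_ulim : K_inf_compact (bellman c q 1%R ulim).
Proof.
apply: K_inf_compact_bellman => //; exact: ulim_lower_semicontinuous.
Qed.

Let bellman_ulim_le p (l : \bar R) :
  (forall n, bellman c q (alpha n) (U n) p <= l) -> bellman c q 1%R ulim p <= l.
Proof.
move=> bl.
have intc : \int[q p]_y U n y @[n --> \oo] --> \int[q p]_y ulim y.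
  have -> : \int[q p]_y ulim y = \int[q p]_y limn (U ^~ y).
    by apply: eq_integral => y _; apply/esym/cvg_lim.
  by apply: cvg_monotone_convergence => // y _; exact: U_nd.
have alE : (alpha n)%:E @[n --> \oo] --> (1%R : R)%:E.
  by apply: cvg_EFin => //; exact: nearW.
have : bellman c q (alpha n) (U n) p @[n --> \oo] --> bellman c q 1%R ulim p.
  apply: cvgeD.
  - by apply: ge0_adde_def; rewrite inE// mule_ge0 ?lee_fin// integral_ge0.
  - exact: cvg_cst.
  - apply: cvgeM => //; have [If|If] := boolP (\int[q p]_y ulim y \is a fin_num).
      exact: mule_def_fin.
    by apply: mule_def_neq0_infty => //; rewrite onee_neq0.
move=> bc; rewrite -(cvg_lim _ bc)//; apply: lime_le; first exact: cvgP bc.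
exact: nearW.
Qed.

(** The discounted cost of a nearly optimal policy for the average-cost
    criterion bounds m from above. *)
Let r_le_w_star (l : R) : w_star c q < l%:E ->
  exists N, forall n, (N <= n)%N -> (r n <= l)%R.
Proof.
move=> wl; have [b [wb bl]] : exists b : R, w_star c q < b%:E /\ (b < l)%R.
  move: wl; case: (w_star c q) => [s| |]//.
    by rewrite lte_fin => sl; exists ((s + l) / 2)%R; rewrite lte_fin; split; lra.
  by move=> _; exists (l - 1)%R; rewrite ltNyr; split=> //; lra.
have [_ [x _ <-] xb] := ereal_inf_lt wb.
have [_ [pi _ <-] /(discounted_le_average mc c0)[M M0 MP]] := ereal_inf_lt xb.
have M1 : (0 < M + 1)%R by rewrite ltr_wpDl.
have e0 : (0 < (l - b) / (M + 1))%R by rewrite divr_gt0// subr_gt0.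
have /cvgrPdist_lt/(_ _ e0)[N _ NP] := alpha_cvg.
exists N => n Nn; have /andP[an0 an1] := alpha_range n.
have := NP n Nn; rewrite /= ger0_norm; last by rewrite subr_ge0 ltW.
rewrite ltr_pdivlMr// => lt.
rewrite -lee_fin; apply: le_trans (_ : (b + (1 - alpha n) * M)%:E <= _); last first.
  rewrite lee_fin; have : (0 <= 1 - alpha n)%R by rewrite subr_ge0 ltW.
  by move=> a1; nra.
apply: le_trans (MP _ (alpha_range n)); rewrite /r EFinM -mE.
apply: lee_wpmul2l; first by rewrite lee_fin subr_ge0 ltW.
apply: (@le_trans _ _ (v n x)); first by apply: ereal_inf_lbound; exists x.
by apply: ereal_inf_lbound; exists pi.
Qed.

(** For each k, the functions alpha_k and U_k that enter the k-th Bellman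
    operator are smaller than those of any later n; an action that is optimal
    for a suitable n >= k therefore costs at most w + u + e in the k-th
    problem, and [K_inf_compact_limit] applies. Iterating the inequality along
    a stationary policy of minimizers bounds its average cost by w. *)
Lemma average_cost_inequality (w : R) : (0 <= w)%R ->
  (forall k (e : R), (0 < e)%R -> exists2 n, (k <= n)%N & (r n <= w + e)%R) ->
  (exists phi : {mfun X >-> A}, forall x,
     bellman c q 1%R ulim (x, phi x) <= w%:E + ulim x) /\ w_star c q <= w%:E.
Proof.
move=> w0 rw.
have opt x : exists b, bellman c q 1%R ulim (x, b) <= w%:E + ulim x.
  have KB n : K_inf_compact (bellman c q (alpha n) (U n)).
    by apply: K_inf_compact_bellman.
  have BS n p : bellman c q (alpha n) (U n) p <= bellman c q (alpha n.+1) (U n.+1) p.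
    apply: le_bellman => //; first by rewrite alpha_ge0 alpha_nd.
    by move=> y; exact: U_nd.
  have [|b _ bP] := @K_inf_compact_limit _ _ _ _ _
      (fun n => bellman c q (alpha n) (U n)) setT x (w + fine (ulim x)) KB closedT BS.
    move=> k e e0; have e20 : (0 < e / 2)%R by rewrite divr_gt0.
    have [N NP] := u_le_ulim x e20.
    have [n Nn rn] := rw (maxn k N) _ e20.
    have [kn {}Nn] : (k <= n)%N /\ (N <= n)%N by apply/andP; rewrite -geq_max.
    have [b bP] := u_ge_bellman n x; exists b => //.
    apply: le_trans (_ : bellman c q (alpha n) (u n) (x, b) <= _).
      apply: le_bellman => //; first by rewrite alpha_ge0 alpha_nd.
      by move=> y; exact: U_le.
    apply: le_trans bP _; have rn' : (r n)%:E <= (w + e / 2)%:E by rewrite lee_fin.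
    apply: le_trans (leeD rn' (NP n Nn)) _.
    by rewrite -(fineK (ulim_fin x)) -!EFinD lee_fin; lra.
  exists b; rewrite -(fineK (ulim_fin x)) -EFinD; exact: bellman_ulim_le.
have B0 p : 0 <= bellman c q 1%R ulim p by exact: bellman_ge0.
have Boo x : exists b, bellman c q 1%R ulim (x, b) < +oo.
  have [b bP] := opt x; exists b; apply: le_lt_trans bP _.
  by rewrite -(fineK (ulim_fin x)) -EFinD ltry.
have [phi phiP] := measurable_minimizer K_inf_compact_bellman_ulim B0 Boo.
have phiw x : bellman c q 1%R ulim (x, phi x) <= w%:E + ulim x.
  by have [b bP] := opt x; exact: le_trans (phiP x b) bP.
split; first by exists phi.
apply: (@le_trans _ _ (w_average c q (stationary_policy R phi) point)).
  apply: (@le_trans _ _ (w_opt c q point)).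
    by apply: ereal_inf_lbound; exists point.
  by apply: ereal_inf_lbound; eexists.
have [s sE] : exists s : R, ulim point = s%:E.
  by exists (fine (ulim point)); rewrite fineK.
have s0 : (0 <= s)%R by rewrite -lee_fin -sE.
apply/lee_addgt0Pr => e e0; rewrite /w_average limn_esup_lim -EFinD.
apply: lime_le; first exact: is_cvg_esups.
(* s / (n + 1) <= e from this index on *)
exists (Num.truncn (s / e)) => // N /= NP; apply: ge_ereal_sup => _ [n /= Nn <-].
rewrite lee_pdivrMl//; apply: le_trans (v_horizon_stationary_le mc c0 point n.+1
  ler01 w0 measurable_ulim ulim_ge0 phiw) _.
rewrite sE -EFinD -EFinM lee_fin.
have -> : (\sum_(0 <= t < n.+1) 1 ^+ t * w = n.+1%:R * w)%R.
  under eq_bigr do rewrite expr1n mul1r.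
  by rewrite sumr_const_nat subn0 mulr_natl.
rewrite mulrDr lerD2l -ler_pdivrMr//; apply: ltW.
apply: lt_le_trans (truncnS_gt _) _; rewrite ler_nat ltnS.
exact: leq_trans Nn.
Qed.

Hypothesis u_ui : forall x b, asymptotically_uniformly_integrable (q (x, b))
  (fun n => u_disc c q (alpha n)).

Let u_ge_ulim x (e : R) : (0 < e)%R ->
  exists N, forall n, (N <= n)%N -> ulim x <= u n x + e%:E.
Proof.
move=> e0; have : nbhs (ulim x) [set s | ulim x - e%:E < s].
  apply: open_nbhs_nbhs; split; first exact: open_ereal_gt_ereal.
  by rewrite /mkset lteBlDr ?lteDl.
move=> /u_cvg_ulim[N _ NP]; exists N => n /NP/ltW.
by rewrite leeBlDr.
Qed.

Let w_star_ge0 : 0 <= w_star c q.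
Proof.
apply: le_ereal_inf_tmp => _ [x _ <-]; apply: le_ereal_inf_tmp => _ [pi _ <-].
by apply: limf_esup_ge0 => // N; rewrite mule_ge0 ?v_horizon_ge0.
Qed.

(** If (1 - alpha_n) m were infinitely often below w* - e, then
    [average_cost_inequality] with w = w* - e would give w* <= w* - e; by the
    Tauberian inequality it is eventually at most w* + e. Hence it converges to
    w*, and the discounted inequality for a fixed action can be passed to the
    limit. *)
Lemma average_cost_optimality_equation_ge0 : exists phi : {mfun X >-> A},
  forall x, w_star c q + ulim x = bellman c q 1%R ulim (x, phi x) /\
    forall b, w_star c q + ulim x <= bellman c q 1%R ulim (x, b).
Proof.
have [W WE] : exists W : R, w_star c q = W%:E.
  by exists (fine (w_star c q)); rewrite fineK// ge0_fin_numE.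
have W0 : (0 <= W)%R by rewrite -lee_fin -WE.
have rW k (e : R) : (0 < e)%R -> exists2 n, (k <= n)%N & (r n <= W + e)%R.
  move=> e0; have [|N NP] := @r_le_w_star (W + e)%R.
    by rewrite WE lte_fin ltrDl.
  by exists (maxn k N); [exact: leq_maxl|apply: NP; exact: leq_maxr].
have [[phi phiP] _] := average_cost_inequality W0 rW.
have Wr (e : R) : (0 < e)%R -> exists N, forall n, (N <= n)%N -> (W <= r n + e)%R.
  move=> e0; apply: contrapT => /forallNP nN.
  have rWe k : exists2 n, (k <= n)%N & (r n < W - e)%R.
    have /existsNP[n /not_implyP[kn /negP]] := nN k.
    by rewrite -ltNge => lt; exists n => //; lra.
  (* since (1 - alpha_n) m >= 0 *)
  have We0 : (0 <= W - e)%R.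
    by have [n _ /ltW] := rWe 0%N; exact: le_trans.
  have [k e' e'0|_] := average_cost_inequality We0 _.
    by have [n kn /ltW rn] := rWe k; exists n => //; apply: le_trans rn _; lra.
  by rewrite WE lee_fin leNgt => /negP; apply; lra.
have main x b : w_star c q + ulim x <= bellman c q 1%R ulim (x, b).
  apply/lee_addgt0Pr => e e0.
  have e30 : (0 < e / 3)%R by rewrite divr_gt0.
  have [N1 P1] := Wr _ e30; have [N2 P2] := u_ge_ulim x e30.
  have qT : q (x, b) setT < +oo by rewrite prob_kernel ltry.
  have [N3 P3] := asymptotically_uniformly_integrable_limit qT measurable_u
      u_ge0 u_fin ulim_fin u_cvg_ulim (u_ui x b) e30.
  pose n := maxn N1 (maxn N2 N3).
  have n1 : (N1 <= n)%N by exact: leq_maxl.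
  have n2 : (N2 <= n)%N by rewrite !leq_max leqnn orbT.
  have n3 : (N3 <= n)%N by rewrite !leq_max leqnn !orbT.
  have le1 : w_star c q + ulim x <= (r n)%:E + u n x + (e / 3 + e / 3)%:E.
    rewrite WE EFinD addeACA; apply: leeD; last exact: P2.
    by rewrite -EFinD lee_fin P1.
  apply: le_trans le1 _; apply: le_trans (leeD2r _ (u_le_bellman n x b)) _.
  have le2 : bellman c q (alpha n) (u n) (x, b) <=
      bellman c q 1%R ulim (x, b) + (e / 3)%:E.
    rewrite /bellman -addeA leeD2l// mul1e; apply: le_trans (P3 n n3).
    rewrite -[leRHS]mul1e lee_wpmul2r ?integral_ge0// lee_fin.
    by have /andP[_ /ltW] := alpha_range n.
  apply: le_trans (leeD2r _ le2) _; rewrite -addeA leeD2l// -EFinD lee_fin.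
  lra.
exists phi => x; split; last exact: main.
by apply/eqP; rewrite eq_le main/= WE phiP.
Qed.

End vanishing_discount.

(** * Costs bounded below *)

Lemma ereal_inf_shift (R : realType) (I : Type) (S : set I) (f : I -> \bar R)
    (s : R) : ereal_inf [set f i + s%:E | i in S] = ereal_inf [set f i | i in S] + s%:E.
Proof.
apply/eqP; rewrite eq_le; apply/andP; split.
  rewrite -leeBlDr//; apply: le_ereal_inf_tmp => _ [i Si <-].
  by rewrite leeBlDr//; apply: ereal_inf_lbound; exists i.
apply: le_ereal_inf_tmp => _ [i Si <-].
by rewrite leeD2r//; apply: ereal_inf_lbound; exists i.
Qed.

Lemma limn_esup_shift (R : realType) (f : nat -> \bar R) (s : R) :
  limn_esup (fun n => f n + s%:E) = limn_esup f + s%:E.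
Proof.
apply: oppe_inj; rewrite -limn_einfN.
have -> : -%E \o (fun n => f n + s%:E) = (fun n => - s%:E + - f n).
  by apply/funext => n /=; rewrite fin_num_oppeD// addeC.
rewrite limn_einf_shift// (_ : (fun n => - f n) = -%E \o f)// limn_einfN.
by rewrite fin_num_oppeD// addeC.
Qed.

(** For s < 0 the integrand f + s changes sign; the identity (f + s)^+ - s = f
    + (f + s)^- between nonnegative functions avoids distinguishing whether f
    is integrable. *)
Lemma integral_shift (R : realType) d (T : measurableType d)
    (P : probability T R) (f : T -> \bar R) (s : R) :
  measurable_fun setT f -> (forall x, 0 <= f x) ->
  \int[P]_x (f x + s%:E) = \int[P]_x f x + s%:E.
Proof.
move=> mf f0; pose g x := f x + s%:E.
have mg : measurable_fun setT g by apply: emeasurable_funD.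
have cstI (r : R) : \int[P]_(x in setT) (cst r%:E : T -> \bar R) x = r%:E.
  by rewrite integral_cst// [X in r%:E * X]probability_setT mule1.
have mcst (r : R) : measurable_fun setT (cst r%:E : T -> \bar R) by [].
have addI (k : T -> \bar R) (r : R) : measurable_fun setT k ->
    (forall x, 0 <= k x) -> (0 <= r)%R ->
    \int[P]_x (k x + r%:E) = \int[P]_x k x + r%:E.
  move=> mk k0 r0.
  have r0' x : setT x -> 0 <= (cst r%:E : T -> \bar R) x by rewrite /= lee_fin.
  transitivity (\int[P]_x k x + \int[P]_(x in setT) (cst r%:E : T -> \bar R) x).
    by apply: ge0_integralD.
  by rewrite cstI.
have [s0|s0] := leP 0%R s; first exact: addI.
have ms0 : (0 <= - s)%R by rewrite oppr_ge0 ltW.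
have ng x : g^\- x <= (- s)%:E.
  rewrite funenegE ge_max lee_fin ms0 andbT /g EFinN leeN2 leeDr//.
have gE x : g^\+ x + (- s)%:E = f x + g^\- x.
  rewrite funenegE funeposE /g; move: (f0 x); case: (f x) => [r| |]//; last first.
    by rewrite [+oo + s%:E]addye// max_l ?leey// max_r ?leNye// addye// adde0.
  move=> r0; rewrite -EFinD -EFinN -!EFin_max -!EFinD; congr (_%:E).
  rewrite !maxEle; case: ifP; case: ifP; lra.
have Nfin : \int[P]_x g^\- x \is a fin_num.
  rewrite ge0_fin_numE; last exact: integral_ge0.
  apply: le_lt_trans (ltry (- s)%R); rewrite -cstI; apply: ge0_le_integral => //.
  exact: measurable_funeneg.
have : \int[P]_x g^\+ x + (- s)%:E = \int[P]_x f x + \int[P]_x g^\- x.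
  rewrite -addI//; last exact: measurable_funepos.
  rewrite -ge0_integralD//; first by apply: eq_integral => x _; exact: gE.
  exact: measurable_funeneg.
have -> : \int[P]_x (f x + s%:E) = \int[P]_x g^\+ x - \int[P]_x g^\- x.
  exact: integralE.
move: Nfin.
have : 0 <= \int[P]_x f x by exact: integral_ge0.
case: (\int[P]_x g^\- x) => // N; case: (\int[P]_x f x) => [F| |]//;
  case: (\int[P]_x g^\+ x) => [G| |]//= _ _.
by move=> [GF]; congr EFin; lra.
Qed.

Section cost_shift.
Context (R : realType) d d' (X : measurableType d) (A : measurableType d').
Variables (c : X * A -> \bar R) (q : R.-pker (X * A) ~> X) (b : R).
Hypotheses (mc : measurable_fun setT c) (c0 : forall p, 0 <= c p).

Definition shifted_cost (p : X * A) : \bar R := c p + b%:E.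

Let scaled_ge0 (a : R) t p : (0 <= a)%R -> 0 <= (a ^+ t)%:E * c p.
Proof. by move=> a0; rewrite mule_ge0// lee_fin exprn_ge0. Qed.

Let scaled_shift (a : R) t p : (a ^+ t)%:E * shifted_cost p =
  (a ^+ t)%:E * c p + (a ^+ t * b)%:E.
Proof. by rewrite /shifted_cost muleDr// ?EFinM// fin_num_adde_defl. Qed.

Let measurable_scaled (a : R) t : measurable_fun setT
  (fun w : trajectory X A => (a ^+ t)%:E * c (state t w, action t w)).
Proof. by apply: measurable_funeM; exact: measurable_trajectory_cost. Qed.

Let sum_shift (a : R) N (w : trajectory X A) :
  \sum_(0 <= t < N) (a ^+ t)%:E * shifted_cost (state t w, action t w) =
  \sum_(0 <= t < N) (a ^+ t)%:E * c (state t w, action t w) +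
    (\sum_(0 <= t < N) a ^+ t * b)%:E.
Proof.
rewrite -sumEFin -big_split/=; apply: eq_bigr => t _; exact: scaled_shift.
Qed.

Lemma v_horizon_shift N (a : R) pi x : (0 <= a)%R ->
  v_horizon shifted_cost q N a pi x =
  v_horizon c q N a pi x + (\sum_(0 <= t < N) a ^+ t * b)%:E.
Proof.
move=> a0; rewrite /v_horizon -integral_shift.
- by apply: eq_integral => w _; exact: sum_shift.
- by apply: emeasurable_sum => t; exact: measurable_scaled.
- by move=> w; apply: sume_ge0 => t _; exact: scaled_ge0.
Qed.

Lemma v_discounted_shift (a : R) pi x : (0 <= a < 1)%R ->
  v_discounted shifted_cost q a pi x =
  v_discounted c q a pi x + (b / (1 - a))%:E.
Proof.
move=> /andP[a0 a1].
have gc : (\sum_(0 <= t < n) a ^+ t * b)%R @[n --> \oo] --> (b / (1 - a))%R.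
  have -> : (fun n => \sum_(0 <= t < n) a ^+ t * b)%R = series (geometric b a).
    by apply/funext => n; apply: eq_bigr => t _; rewrite /geometric/= mulrC.
  by apply: cvg_geometric_series; rewrite ger0_norm.
rewrite /v_discounted -integral_shift.
- apply: eq_integral => w _; apply/cvg_lim => //.
  under eq_cvg do rewrite sum_shift.
  apply: cvgeD; first by rewrite fin_num_adde_defl.
    by apply: is_cvg_nneseries => t _ _; exact: scaled_ge0.
  apply: cvg_EFin; first exact: nearW.
  exact: gc.
- apply: ge0_emeasurable_sum => [t w _ _|t _]; first exact: scaled_ge0.
  exact: measurable_scaled.
- by move=> w; apply: nneseries_ge0 => t _ _; exact: scaled_ge0.
Qed.

Lemma v_opt_shift (a : R) x : (0 <= a < 1)%R ->
  v_opt shifted_cost q a x = v_opt c q a x + (b / (1 - a))%:E.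
Proof.
move=> a01; rewrite /v_opt -ereal_inf_shift; congr ereal_inf.
by apply: eq_imagel => pi _; exact: v_discounted_shift.
Qed.

(** A constant added to the cost moves the optimal values at all states by the
    same amount. *)
Lemma u_disc_shift (a : R) x : (0 <= a < 1)%R ->
  u_disc shifted_cost q a x = u_disc c q a x.
Proof.
move=> a01; rewrite /u_disc (v_opt_shift x a01).
have mE : m_disc shifted_cost q a = m_disc c q a + (b / (1 - a))%:E.
  rewrite /m_disc -ereal_inf_shift; congr ereal_inf.
  by apply: eq_imagel => y _; exact: v_opt_shift.
rewrite mE; move: (v_opt c q a x) (m_disc c q a) (b / (1 - a))%R => v m s.
by rewrite fin_num_oppeD// addeACA subee// adde0.
Qed.

Lemma w_average_shift pi x :
  w_average shifted_cost q pi x = w_average c q pi x + b%:E.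
Proof.
rewrite /w_average -limn_esup_shift; congr limn_esup; apply/funext => N.
rewrite v_horizon_shift//.
have -> : (\sum_(0 <= t < N.+1) 1 ^+ t * b = N.+1%:R * b)%R.
  under eq_bigr do rewrite expr1n mul1r.
  by rewrite sumr_const_nat subn0 mulr_natl.
rewrite muleDr//; last by rewrite fin_num_adde_defl.
by rewrite -[(_^-1)%:E * (_ * b)%:E]EFinM mulKf.
Qed.

Lemma w_star_shift : w_star shifted_cost q = w_star c q + b%:E.
Proof.
rewrite /w_star -ereal_inf_shift; congr ereal_inf; apply: eq_imagel => x _.
rewrite /w_opt -ereal_inf_shift; congr ereal_inf.
by apply: eq_imagel => pi _; exact: w_average_shift.
Qed.

End cost_shift.

Lemma K_inf_compact_shift (R : realType) (X A : topologicalType)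
    (c : X * A -> \bar R) (b : R) :
  K_inf_compact c -> K_inf_compact (fun p => c p + b%:E).
Proof.
move=> Kc K K0 cK l.
suff -> : [set p | c p + b%:E <= l%:E] = [set p | c p <= (l - b)%:E] by exact: Kc.
by apply/seteqP; split => p /=; rewrite EFinB leeBrDr.
Qed.

Lemma lty_shift (R : realType) (b : R) (y z : \bar R) :
  y = z + b%:E -> y < +oo -> z < +oo.
Proof. by move=> ->; case: z => // z _; exact: ltry. Qed.

Lemma optimality_equation_shift (R : realType) d d' (X : measurableType d)
    (A : measurableType d') (c c' : X * A -> \bar R) (q : R.-pker (X * A) ~> X)
    (b : R) (phi : X -> A) (u u' : X -> \bar R) (w w' : \bar R) :
  c = shifted_cost c' b -> w = w' + b%:E -> u =1 u' ->
  (forall x, w' + u' x = bellman c' q 1%R u' (x, phi x) /\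
     forall a, w' + u' x <= bellman c' q 1%R u' (x, a)) ->
  forall x, w + u x = c (x, phi x) + \int[q (x, phi x)]_y u y /\
    is_minimum [set c (x, a) + \int[q (x, a)]_y u y | a in [set: A]] (w + u x).
Proof.
move=> cE wE uE opt x.
have bE a : c (x, a) + \int[q (x, a)]_y u y = bellman c' q 1%R u' (x, a) + b%:E.
  rewrite /bellman mul1e cE /shifted_cost addeAC.
  by congr (_ + _ + _); apply: eq_integral => y _.
have [eqx lex] := opt x.
have wuE : w + u x = bellman c' q 1%R u' (x, phi x) + b%:E.
  by rewrite -eqx wE uE addeAC.
split; first by rewrite wuE bE.
split; first by exists (phi x) => //; rewrite wuE bE.
by move=> _ [a _ <-]; rewrite wuE bE leeD2r// -eqx.
Qed.

Unset Implicit Arguments.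

Theorem theorem3p8 (R : realType) (PX PA : polishType R)
  (X : borelSubset PX) (A : borelSubset PA)
  (c : X * A -> \bar R) (q : R.-pker (X * A) ~> X)
  (c_measurable : measurable_fun [set: X * A] c)
  (c_bounded_below : exists b : R, forall p, b%:E <= c p)
  (c_K_inf_compact : K_inf_compact c)
  (q_weakly_continuous : weakly_continuous q)
  (alpha : nat -> R)
  (alpha_range : forall n, (0 <= alpha n < 1)%R)
  (alpha_nondecreasing : nondecreasing_seq alpha)
  (alpha_cvg : alpha n @[n --> \oo] --> (1%R : R))
  (w_star_finite : w_star c q < +oo)
  (u_liminf_finite : forall x,
    limn_einf (fun n => u_disc c q (alpha n) x) < +oo)
  (u_real_valued : forall n x, u_disc c q (alpha n) x \is a fin_num)
  (u_lower_semi_equicontinuous :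
    lower_semi_equicontinuous (fun n (x : X) => fine (u_disc c q (alpha n) x)))
  (u_cvg : forall x, cvg (u_disc c q (alpha n) x @[n --> \oo]))
  (u_asymptotically_uniformly_integrable : forall x a,
    asymptotically_uniformly_integrable (q (x, a))
      (fun n => u_disc c q (alpha n))) :
  let u := u_liminf c q alpha in
  exists phi : {mfun X >-> A}, forall x : X,
    w_star c q + u x = c (x, phi x) + \int[q (x, phi x)]_y u y /\
    is_minimum [set c (x, a) + \int[q (x, a)]_y u y | a in [set: A]]
      (w_star c q + u x).
Proof.
have [b [c' [c'0 mc' Kc' cE]]] : exists b (c' : X * A -> \bar R),
    [/\ forall p, 0 <= c' p, measurable_fun setT c', K_inf_compact c' &
        c = shifted_cost c' b].
  have [b cb] := c_bounded_below; exists b, (fun p => c p + (- b)%:E); split.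
  - by move=> p; rewrite EFinN sube_ge0.
  - exact: emeasurable_funD.
  - exact: K_inf_compact_shift.
  - by apply/funext => p; rewrite /shifted_cost EFinN subeK.
have uE n x : u_disc c q (alpha n) x = u_disc c' q (alpha n) x.
  by rewrite cE u_disc_shift.
have uE' : (fun n => u_disc c q (alpha n)) = (fun n => u_disc c' q (alpha n)).
  by apply/funext => n; apply/funext => x; exact: uE.
have ulE x : u_liminf c q alpha x = u_liminf c' q alpha x.
  exact: (congr1 (fun f : nat -> X -> \bar R => limn_einf (f ^~ x)) uE').
have wE : w_star c q = w_star c' q + b%:E by rewrite cE w_star_shift.
have w'oo : w_star c' q < +oo := lty_shift wE w_star_finite.
have ufin := eq_ind _ (fun f : nat -> X -> \bar R =>
  forall n x, f n x \is a fin_num) u_real_valued _ uE'.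
have lse := eq_ind _ (fun f : nat -> X -> \bar R =>
  lower_semi_equicontinuous (fun n x => fine (f n x)))
  u_lower_semi_equicontinuous _ uE'.
have ucvg := eq_ind _ (fun f : nat -> X -> \bar R =>
  forall x, cvg (f n x @[n --> \oo])) u_cvg _ uE'.
have ulty := eq_ind _ (fun f : nat -> X -> \bar R =>
  forall x, limn_einf (f ^~ x) < +oo) u_liminf_finite _ uE'.
have ui := eq_ind _ (fun f : nat -> X -> \bar R => forall x a,
  asymptotically_uniformly_integrable (q (x, a)) f)
  u_asymptotically_uniformly_integrable _ uE'.
have [phi phiP] := average_cost_optimality_equation_ge0 mc' c'0 Kc'
  q_weakly_continuous alpha_range alpha_nondecreasing alpha_cvg w'oo ufin lse
  ucvg ulty ui.
move=> u; exists phi; exact: optimality_equation_shift cE wE ulE phiP.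
Qed.
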